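(* Let $p$ be an odd prime and let $F$ be a field with $\operatorname{char}(F)\ne p$ and $\mu_p\not\subseteq F$. Let $L=F(\mu_p)$, $H=\mathrm{Gal}(L/F)$, let $\omega\in L$ be a primitive $p$-th root of unity, and let $\alpha:H\to(\mathbb Z/p\mathbb Z)^*$ be the cyclotomic character. Let $\chi:H\to(\mathbb Z/p\mathbb Z)^*$ be a character. Take any $a,b\in L^*$ with $[a]\in(L^*/L^{*p})^{(\chi)}$ and $[b]\in(L^*/L^{*p})^{(\alpha\chi^{-1})}$, and let $A=(a,b;L)_\omega$. Then there is a central simple algebra $B$ of degree $p$ over $F$ with $B\otimes_FL\cong A$. Furthermore, $B$ is a cyclic algebra if and only if there exist $a',b'\in L^*$ with $[a']\in(L^*/L^{*p})^{(\alpha)}$ and $[b']\in(L^*/L^{*p})^H$ such that $A\cong(a',b';L)_\omega$.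
   Context: $\mu_p$ is the group of $p$-th roots of unity; $\alpha$ is given by $h(\zeta)=\zeta^{\alpha(h)}$ for $h\in H$, $\zeta\in\mu_p$. $[c]$ denotes the class of $c\in L^*$ in $L^*/L^{*p}$. For a character $\psi:H\to(\mathbb Z/p\mathbb Z)^*$, $(L^*/L^{*p})^{(\psi)}=\{[c]\mid h\cdot[c]=[c]^{\psi(h)}\ \forall h\in H\}$; $(L^*/L^{*p})^H$ is the fixed subgroup. $(a,b;L)_\omega$ denotes the $p^2$-dimensional symbol algebra over $L$ with generators $i,j$ and relations $i^p=a$, $j^p=b$, $ij=\omega ji$. A cyclic algebra of degree $p$ over $F$ is an algebra of the form $(S/F,\sigma,c)=\bigoplus_{i=0}^{p-1}Sx^i$ with $S$ a cyclic Galois field extension of $F$ of degree $p$, $\mathrm{Gal}(S/F)=\langle\sigma\rangle$, $c\in F^*$, $x^p=c$, $xsx^{-1}=\sigma(s)$ for $s\in S$.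
   Formalization: The ''if and only if'' is stated only when F has some cyclic Galois field extension of degree p or A is a division algebra; otherwise it is false, e.g. F = R, p = 3, a = b = 1: B = M_3(R) is not cyclic, yet a' = b' = 1 works. *)

(* Defs.v *)
From HB Require Import structures.
From mathcomp Require Import all_boot all_algebra all_fingroup all_solvable.
From mathcomp Require Import all_field.

Set Implicit Arguments.
Unset Strict Implicit.
Unset Printing Implicit Defensive.

Import GRing.Theory.
Local Open Scope ring_scope.

(* A finite-dimensional associative unital K-algebra given on a basis e_i by
   e_i e_j = \sum_k sc_mul i j k e_k and 1 = \sum_i sc_one i e_i. *)
Record sc_table (K : fieldType) := SCTable {
  sc_idx : finType;
  sc_mul : sc_idx -> sc_idx -> sc_idx -> K;
  sc_one : sc_idx -> K;
  sc_mulA : forall i j k l,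
    \sum_m sc_mul j k m * sc_mul i m l = \sum_m sc_mul i j m * sc_mul m k l;
  sc_mul1l : forall j k, \sum_i sc_one i * sc_mul i j k = (j == k)%:R;
  sc_mul1r : forall i k, \sum_j sc_one j * sc_mul i j k = (i == k)%:R;
  sc_one_neq0 : exists i, sc_one i != 0
}.

Definition sc_alg (K : fieldType) (D : sc_table K) : Type :=
  {ffun sc_idx D -> K^o}.

Section StructureConstantAlgebra.
Variables (K : fieldType) (D : sc_table K).
Local Notation I := (sc_idx D).
Local Notation c := (@sc_mul K D).
Local Notation A := (sc_alg D).

HB.instance Definition _ := Vector.on A.

Implicit Types x y z : A.

Definition sc_algM x y : A :=
  [ffun k => \sum_i \sum_j x i * y j * c i j k].

Definition sc_alg1 : A := [ffun k => sc_one k].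

Fact sc_algMA : associative sc_algM.
Proof.
move=> x y z; apply/ffunP=> l; rewrite !ffunE.
transitivity (\sum_i \sum_j \sum_k
    x i * y j * z k * (\sum_m c j k m * c i m l)).
  apply: eq_bigr => i _.
  transitivity (\sum_m \sum_j \sum_k x i * y j * z k * (c j k m * c i m l)).
    apply: eq_bigr => m _; rewrite ffunE mulr_sumr mulr_suml.
    apply: eq_bigr => j _; rewrite mulr_sumr mulr_suml.
    by apply: eq_bigr => k _; rewrite !mulrA.
  rewrite exchange_big; apply: eq_bigr => j _.
  rewrite exchange_big; apply: eq_bigr => k _.
  by rewrite -mulr_sumr.
transitivity (\sum_m \sum_k \sum_i \sum_j
    x i * y j * z k * (c i j m * c m k l)); last first.
  apply: eq_bigr => m _; apply: eq_bigr => k _; rewrite ffunE !mulr_suml.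
  apply: eq_bigr => i _; rewrite !mulr_suml.
  apply: eq_bigr => j _; rewrite !mulrA; congr (_ * _).
  by rewrite -!mulrA; congr (_ * (_ * _)); rewrite mulrC.
under [RHS]eq_bigr do rewrite exchange_big.
rewrite [RHS]exchange_big; apply: eq_bigr => i _.
under [RHS]eq_bigr do rewrite exchange_big.
rewrite [RHS]exchange_big; apply: eq_bigr => j _.
rewrite [RHS]exchange_big; apply: eq_bigr => k _.
by rewrite -mulr_sumr sc_mulA.
Qed.

Fact sc_alg1M : left_id sc_alg1 sc_algM.
Proof.
move=> x; apply/ffunP=> k; rewrite ffunE exchange_big.
have h j : \sum_i sc_alg1 i * x j * c i j k = (j == k)%:R * x j.
  rewrite -(@sc_mul1l _ D) mulr_suml; apply: eq_bigr => i _.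
  by rewrite ffunE mulrAC.
rewrite (eq_bigr _ (fun j _ => h j)) (bigD1 k) //= eqxx mul1r.
by rewrite big1 ?addr0 // => j /negbTE ->; rewrite mul0r.
Qed.

Fact sc_algM1 : right_id sc_alg1 sc_algM.
Proof.
move=> x; apply/ffunP=> k; rewrite ffunE.
have h i : \sum_j x i * sc_alg1 j * c i j k = x i * (i == k)%:R.
  rewrite -(@sc_mul1r _ D) mulr_sumr; apply: eq_bigr => j _.
  by rewrite ffunE mulrA.
rewrite (eq_bigr _ (fun i _ => h i)) (bigD1 k) //= eqxx mulr1.
by rewrite big1 ?addr0 // => i /negbTE ->; rewrite mulr0.
Qed.

Fact sc_algMDl : left_distributive sc_algM +%R.
Proof.
move=> x y z; apply/ffunP=> k; rewrite !ffunE -big_split; apply: eq_bigr => i _.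
rewrite -big_split; apply: eq_bigr => j _.
by rewrite ffunE !mulrDl.
Qed.

Fact sc_algMDr : right_distributive sc_algM +%R.
Proof.
move=> x y z; apply/ffunP=> k; rewrite !ffunE -big_split; apply: eq_bigr => i _.
rewrite -big_split; apply: eq_bigr => j _.
by rewrite ffunE mulrDr !mulrDl.
Qed.

Fact sc_alg1_neq0 : sc_alg1 != 0.
Proof.
have [i ni] := sc_one_neq0 D; apply/eqP => /ffunP/(_ i).
by rewrite !ffunE => /eqP; apply/negP.
Qed.

HB.instance Definition _ := GRing.Zmodule_isNzRing.Build A
  sc_algMA sc_alg1M sc_algM1 sc_algMDl sc_algMDr sc_alg1_neq0.

Fact sc_algZAl (a : K) x y : a *: (x * y) = (a *: x) * y.
Proof.
apply/ffunP=> k; rewrite !ffunE scaler_sumr; apply: eq_bigr => i _.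
rewrite scaler_sumr; apply: eq_bigr => j _.
by rewrite ffunE; change (a * (x i * y j * c i j k) = a * x i * y j * c i j k);
  rewrite !mulrA.
Qed.

HB.instance Definition _ := GRing.Lmodule_isLalgebra.Build K A sc_algZAl.

Fact sc_algZAr (a : K) x y : a *: (x * y) = x * (a *: y).
Proof.
apply/ffunP=> k; rewrite !ffunE scaler_sumr; apply: eq_bigr => i _.
rewrite scaler_sumr; apply: eq_bigr => j _.
rewrite ffunE; change (a * (x i * y j * c i j k) = x i * (a * y j) * c i j k).
by rewrite !mulrA (mulrC a).
Qed.

HB.instance Definition _ := GRing.Lalgebra_isAlgebra.Build K A sc_algZAr.
HB.instance Definition _ := Algebra_isFalgebra.Build K A.

Definition sc_base (i : I) : A := [ffun k => (i == k)%:R].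

Lemma sc_algE x : x = \sum_i x i *: sc_base i.
Proof.
apply/ffunP=> k; rewrite sum_ffunE (bigD1 k) //= !ffunE eqxx.
by rewrite big1 ?addr0 ?[_ *: _]mulr1 // => i ik; rewrite !ffunE (negbTE ik) scaler0.
Qed.

Lemma sc_baseM i j : sc_base i * sc_base j = \sum_k c i j k *: sc_base k.
Proof.
rewrite [LHS]sc_algE; apply: eq_bigr => k _; congr (_ *: _).
rewrite ffunE (bigD1 i) //= (bigD1 j) //= !ffunE !eqxx !mul1r.
rewrite !big1 ?addr0 // => [l li|l lj].
  rewrite big1 // => m _; rewrite !ffunE [i == l]eq_sym (negbTE li).
  by rewrite !mul0r.
by rewrite !ffunE [j == l]eq_sym (negbTE lj) mulr0 mul0r.
Qed.

Lemma dim_sc_alg : \dim {: A} = #|I|.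
Proof. by rewrite dimvf /dim /= muln1. Qed.

End StructureConstantAlgebra.

Section ScalarExtension.
Variables (F : fieldType) (B : falgType F) (L : fieldExtType F).
Local Notation n := (\dim {:B}).
Local Notation e := (vbasis {:B}).

Let mulB (i j k : 'I_n) : L := (coord e k (e`_i * e`_j))%:A.
Let oneB (i : 'I_n) : L := (coord e i 1)%:A.

Let coordE (v : B) : v = \sum_i coord e i v *: e`_i.
Proof. exact: coord_vbasis (memvf v). Qed.

Let coord_e (i j : 'I_n) : coord e i e`_j = (i == j)%:R.
Proof. by rewrite coord_free ?(basis_free (vbasisP _)) // eq_sym. Qed.

Fact ext_scalars_mulA i j k l :
  \sum_m mulB j k m * mulB i m l = \sum_m mulB i j m * mulB m k l.
Proof.
transitivity ((coord e l (e`_i * (e`_j * e`_k)))%:A : L).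
  rewrite [in RHS](coordE (_`_j * _)) mulr_sumr linear_sum /= scaler_suml.
  apply: eq_bigr => m _.
  by rewrite /mulB -[in RHS]scalerAr linearZ /= -scalerA mulr_algl.
rewrite mulrA [in LHS](coordE (_`_i * _)) mulr_suml linear_sum /= scaler_suml.
apply: eq_bigr => m _.
by rewrite /mulB -[in LHS]scalerAl linearZ /= -scalerA mulr_algl.
Qed.

Fact ext_scalars_mul1l j k : \sum_i oneB i * mulB i j k = (j == k)%:R.
Proof.
transitivity ((coord e k (1 * e`_j))%:A : L); last first.
  by rewrite mul1r coord_e eq_sym scaler_nat.
rewrite [in RHS](coordE 1) mulr_suml linear_sum /= scaler_suml.
apply: eq_bigr => i _.
by rewrite /mulB /oneB -[in RHS]scalerAl linearZ /= -scalerA mulr_algl.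
Qed.

Fact ext_scalars_mul1r i k : \sum_j oneB j * mulB i j k = (i == k)%:R.
Proof.
transitivity ((coord e k (e`_i * 1))%:A : L); last first.
  by rewrite mulr1 coord_e eq_sym scaler_nat.
rewrite [in RHS](coordE 1) mulr_sumr linear_sum /= scaler_suml.
apply: eq_bigr => j _.
by rewrite /mulB /oneB -[in RHS]scalerAr linearZ /= -scalerA mulr_algl.
Qed.

Fact ext_scalars_one_neq0 : exists i, oneB i != 0.
Proof.
apply/existsP; apply: contraNT (oner_neq0 B); rewrite negb_exists => /forallP h.
rewrite [1]coordE big1 // => i _; have := h i.
rewrite negbK /oneB -in_algE fmorph_eq0 => /eqP ->.
by rewrite scale0r.
Qed.

Definition ext_scalars_table : sc_table L :=
  SCTable ext_scalars_mulA ext_scalars_mul1l ext_scalars_mul1r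
    ext_scalars_one_neq0.

(* The L-algebra B \otimes_F L, on the L-basis e_i \otimes 1, where (e_i) is an
   F-basis of B; by ext_scalars_univ it does not depend on the basis chosen. *)
Definition ext_scalars : falgType L := sc_alg ext_scalars_table.

Definition tens (b : B) (l : L) : ext_scalars :=
  l *: ([ffun i => (coord e i b)%:A] : sc_alg ext_scalars_table).

Lemma tensDl b b' l : tens (b + b') l = tens b l + tens b' l.
Proof.
rewrite /tens -scalerDr; congr (_ *: _); apply/ffunP=> i.
by rewrite !ffunE linearD scalerDl.
Qed.

Lemma tensDr b l l' : tens b (l + l') = tens b l + tens b l'.
Proof. exact: scalerDl. Qed.

Lemma tensZ (a : F) b l : tens (a *: b) l = tens b (a *: l).
Proof.
apply/ffunP=> i; rewrite !ffunE linearZ /= -scalerA.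
by rewrite -[a *: l]mulr_algl mulrC -[RHS]scalerA [in RHS]/(_ *: _) /= mulr_algl.
Qed.

Lemma scale_tens (a : L) b l : a *: tens b l = tens b (a * l).
Proof. by rewrite /tens scalerA. Qed.

Lemma tens1 : tens 1 1 = 1.
Proof. by rewrite /tens scale1r; apply/ffunP=> i; rewrite !ffunE. Qed.

Lemma tens_base (i : 'I_n) : tens e`_i 1 = sc_base (D := ext_scalars_table) i.
Proof.
rewrite /tens scale1r; apply/ffunP=> j.
by rewrite !ffunE coord_e eq_sym scaler_nat.
Qed.

Lemma tens_sum (I : finType) (a : I -> F) (v : I -> B) l :
  tens (\sum_i a i *: v i) l = \sum_i (a i)%:A *: tens (v i) l.
Proof.
have t0 : tens 0 l = 0.
  by apply: (addrI (tens 0 l)); rewrite -tensDl !addr0.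
elim/big_rec2: _ => [//|i y1 y2 _ <-].
by rewrite tensDl tensZ scale_tens mulr_algl.
Qed.

Lemma tensM b b' l l' : tens b l * tens b' l' = tens (b * b') (l * l').
Proof.
suff t1 : tens b 1 * tens b' 1 = tens (b * b') 1.
  rewrite -[l in LHS]mulr1 -[l' in LHS]mulr1 -!scale_tens -scalerAl -scalerAr.
  by rewrite t1 !scale_tens mulr1.
rewrite {2}[b]coordE {2}[b']coordE mulr_suml.
rewrite [in LHS](coordE b) [in LHS](coordE b') !tens_sum mulr_suml.
under [in RHS]eq_bigr do rewrite -scalerAl.
rewrite tens_sum; apply: eq_bigr => i _.
rewrite -scalerAl mulr_sumr; congr (_ *: _).
rewrite mulr_sumr; under [in RHS]eq_bigr do rewrite -scalerAr.
rewrite tens_sum; apply: eq_bigr => j _.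
rewrite -scalerAr; congr (_ *: _).
rewrite !tens_base sc_baseM [in RHS](coordE (_ * _)) tens_sum.
by apply: eq_bigr => k _; rewrite tens_base.
Qed.

Lemma ext_scalarsE (x : ext_scalars) : x = \sum_(i < n) tens e`_i (x i).
Proof.
rewrite [LHS]sc_algE; apply: eq_bigr => i _.
by rewrite -tens_base scale_tens mulr1.
Qed.

Lemma dim_ext_scalars : \dim {: ext_scalars} = \dim {: B}.
Proof. by rewrite dim_sc_alg /= card_ord. Qed.

Lemma ext_scalars_univ (C : algType L) (g : B -> C) :
    {morph g : x y / x + y} -> (forall (a : F) x, g (a *: x) = a%:A *: g x) ->
    {morph g : x y / x * y} -> g 1 = 1 ->
  exists h : ext_scalars -> C,
    [/\ linear h, {morph h : x y / x * y}, h 1 = 1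
      & forall b, h (tens b 1) = g b]
    /\ (forall h' : ext_scalars -> C, linear h' ->
         (forall b, h' (tens b 1) = g b) -> h' =1 h).
Proof.
move=> gD gZ gM g1.
have g0 : g 0 = 0 by apply: (addrI (g 0)); rewrite -gD !addr0.
have gsum (I : finType) (a : I -> F) (v : I -> B) :
    g (\sum_i a i *: v i) = \sum_i (a i)%:A *: g (v i).
  by elim/big_rec2: _ => [//|i y1 y2 _ <-]; rewrite gD gZ.
pose h (x : ext_scalars) := \sum_(i < n) x i *: g e`_i.
have hL : linear h.
  move=> a x y; rewrite /h scaler_sumr -big_split; apply: eq_bigr => i _.
  by rewrite !ffunE scalerDl scalerA.
have hg b l : h (tens b l) = l *: g b.
  rewrite /h {2}(coordE b) gsum scaler_sumr; apply: eq_bigr => i _.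
  by rewrite !ffunE scalerA.
have h0 : h 0 = 0 by apply: (addrI (h 0)); rewrite -{1}[h 0]scale1r -hL scaler0 !addr0.
have hsum (I : finType) (v : I -> ext_scalars) : h (\sum_i v i) = \sum_i h (v i).
  by elim/big_rec2: _ => [//|i y1 y2 _ <-]; rewrite -[v i]scale1r hL !scale1r.
have hM : {morph h : x y / x * y}.
  move=> x y; rewrite {1}(ext_scalarsE x) {1}(ext_scalarsE y) mulr_suml hsum.
  rewrite [in RHS]/h mulr_suml; apply: eq_bigr => i _.
  rewrite mulr_sumr hsum mulr_sumr; apply: eq_bigr => j _.
  by rewrite tensM hg gM -scalerAl -scalerAr scalerA.
exists h; split; first by split=> // [|b]; rewrite -?tens1 hg scale1r.
move=> h' h'L h'g x.
have h'0 : h' 0 = 0.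
  by apply: (addrI (h' 0)); rewrite -{1}[h' 0]scale1r -h'L scaler0 !addr0.
have h'sum (I : finType) (v : I -> ext_scalars) :
    h' (\sum_i v i) = \sum_i h' (v i).
  by elim/big_rec2: _ => [//|i y1 y2 _ <-]; rewrite -[v i]scale1r h'L !scale1r.
rewrite [x]ext_scalarsE hsum h'sum; apply: eq_bigr => i _.
rewrite hg -h'g -[x i in LHS]mulr1 -scale_tens.
by rewrite -[_ *: tens _ _]addr0 h'L h'0 addr0.
Qed.

End ScalarExtension.

Section SymbolAlgebra.
Variables (L : fieldType) (p : nat) (omega : L).
Hypothesis omega_prim : p.-primitive_root omega.
Variables a b : L.

Let p_gt0 : (0 < p)%N. Proof. exact: prim_order_gt0 omega_prim. Qed.

Let modI (m : nat) : 'I_p := Ordinal (ltn_pmod m p_gt0).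

(* With e_(r,s) = i^r j^s and ij = omega ji, one gets
   e_(r,s) e_(u,v) = omega^(-su) i^(r+u) j^(s+v). *)
Let coef (x y : 'I_p * 'I_p) : L :=
  omega ^- (x.2 * y.1) * a ^+ ((x.1 + y.1) %/ p) * b ^+ ((x.2 + y.2) %/ p).

Let idx (x y : 'I_p * 'I_p) : 'I_p * 'I_p :=
  (modI (x.1 + y.1), modI (x.2 + y.2)).

Let mulS (x y z : 'I_p * 'I_p) : L := if z == idx x y then coef x y else 0.
Let oneS (x : 'I_p * 'I_p) : L := (x == (modI 0, modI 0))%:R.

Let sum_mulS x y (G : 'I_p * 'I_p -> L) :
  \sum_m mulS x y m * G m = coef x y * G (idx x y).
Proof.
rewrite (bigD1 (idx x y)) //= /mulS eqxx big1 ?addr0 // => z /negbTE ->.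
by rewrite mul0r.
Qed.

Let idxA x y z : idx x (idx y z) = idx (idx x y) z.
Proof. by congr (_, _); apply: val_inj; rewrite /= modnDmr modnDml addnA. Qed.

Let divDm (m k : nat) :
  ((m %/ p) + ((m %% p + k) %/ p) = (m + k) %/ p)%N.
Proof. by rewrite {3}(divn_eq m p) -addnA divnMDl. Qed.

Let coefA x y z : coef y z * coef x (idx y z) = coef x y * coef (idx x y) z.
Proof.
case: x y z => [r s] [u v] [w t]; rewrite /coef /=.
have mulAC6 (c1 c2 c3 d1 d2 d3 : L) : c1 * c2 * c3 * (d1 * d2 * d3)
    = (c1 * d1) * (c2 * d2) * (c3 * d3).
  by rewrite mulrACA (mulrACA c1).
have ab c m n k : c ^+ ((n + k) %/ p) * c ^+ ((m + (n + k) %% p) %/ p)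
    = c ^+ ((m + n) %/ p) * c ^+ (((m + n) %% p + k) %/ p) :> L.
  by rewrite -!exprD [(m + _ %% p)%N]addnC !divDm [(n + k + m)%N]addnC addnA.
rewrite !mulAC6 !ab; congr (_ * _ * _).
rewrite -!invfM -!exprD; congr (_^-1).
rewrite -(prim_expr_mod omega_prim) -[RHS](prim_expr_mod omega_prim).
congr (_ ^+ _).
rewrite -[LHS]modnDmr modnMmr modnDmr.
rewrite -[RHS]modnDmr modnMml modnDmr.
by rewrite mulnDr mulnDl addnCA [(v * w + _)%N]addnC.
Qed.

Fact symbol_mulA i j k l :
  \sum_m mulS j k m * mulS i m l = \sum_m mulS i j m * mulS m k l.
Proof.
rewrite !sum_mulS /mulS idxA; case: eqP => _; last by rewrite !mulr0.
exact: coefA.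
Qed.

Let idx0l y : idx (modI 0, modI 0) y = y.
Proof.
case: y => u v; congr (_, _); apply: val_inj; rewrite /= mod0n add0n;
  exact: modn_small.
Qed.

Let idx0r x : idx x (modI 0, modI 0) = x.
Proof.
case: x => u v; congr (_, _); apply: val_inj; rewrite /= mod0n addn0;
  exact: modn_small.
Qed.

Let coef0l y : coef (modI 0, modI 0) y = 1.
Proof.
by rewrite /coef /= !mod0n mul0n !add0n !divn_small // !expr0 invr1 !mulr1.
Qed.

Let coef0r x : coef x (modI 0, modI 0) = 1.
Proof.
by rewrite /coef /= !mod0n muln0 !addn0 !divn_small // !expr0 invr1 !mulr1.
Qed.

Let sum_oneS (G : 'I_p * 'I_p -> L) :
  \sum_m oneS m * G m = G (modI 0, modI 0).
Proof.
rewrite (bigD1 (modI 0, modI 0)) //= /oneS eqxx mul1r.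
by rewrite big1 ?addr0 // => z /negbTE ->; rewrite mul0r.
Qed.

Fact symbol_mul1l j k : \sum_i oneS i * mulS i j k = (j == k)%:R.
Proof. by rewrite sum_oneS /mulS idx0l coef0l eq_sym; case: eqP. Qed.

Fact symbol_mul1r i k : \sum_j oneS j * mulS i j k = (i == k)%:R.
Proof.
rewrite (sum_oneS (fun j => mulS i j k)) /mulS idx0r coef0r eq_sym.
by case: eqP.
Qed.

Fact symbol_one_neq0 : exists i, oneS i != 0.
Proof. by exists (modI 0, modI 0); rewrite /oneS eqxx oner_neq0. Qed.

Definition symbol_table : sc_table L :=
  SCTable symbol_mulA symbol_mul1l symbol_mul1r symbol_one_neq0.

(* (a, b; L)_omega *)
Definition symbol_alg : falgType L := sc_alg symbol_table.

Definition symbol_i : symbol_alg :=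
  sc_base (D := symbol_table) (modI 1, modI 0).
Definition symbol_j : symbol_alg :=
  sc_base (D := symbol_table) (modI 0, modI 1).

Let baseM x y : sc_base (D := symbol_table) x * sc_base (D := symbol_table) y
  = coef x y *: sc_base (D := symbol_table) (idx x y).
Proof.
rewrite sc_baseM (bigD1 (idx x y)) //= /mulS eqxx big1 ?addr0 // => z.
by move/negbTE=> ->; rewrite scale0r.
Qed.

Let base1 : sc_base (D := symbol_table) (modI 0, modI 0) = 1.
Proof. by apply/ffunP=> x; rewrite !ffunE /= /oneS eq_sym. Qed.

Hypothesis p_gt1 : (1 < p)%N.

Let symbol_iX r : symbol_i ^+ r
  = a ^+ (r %/ p) *: sc_base (D := symbol_table) (modI r, modI 0).
Proof.
elim: r => [|r IHr]; first by rewrite expr0 div0n scale1r base1.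
rewrite exprSr {}IHr -scalerAl baseM scalerA /coef /= !mod0n mul0n addn0.
rewrite (modn_small p_gt1) div0n !expr0 invr1 mul1r mulr1 -exprD divDm addn1.
congr (_ *: sc_base _); congr (_, _); apply: val_inj; rewrite /= ?mod0n //.
by rewrite modnDm addn1.
Qed.

Let symbol_jX s : symbol_j ^+ s
  = b ^+ (s %/ p) *: sc_base (D := symbol_table) (modI 0, modI s).
Proof.
elim: s => [|s IHs]; first by rewrite expr0 div0n scale1r base1.
rewrite exprSr {}IHs -scalerAl baseM scalerA /coef /= !mod0n muln0 addn0.
rewrite (modn_small p_gt1) div0n !expr0 invr1 !mul1r -exprD divDm addn1.
congr (_ *: sc_base _); congr (_, _); apply: val_inj; rewrite /= ?mod0n //.
by rewrite modnDm addn1.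
Qed.

Let modIp : modI p = modI 0.
Proof. by apply: val_inj; rewrite /= modnn mod0n. Qed.

Lemma symbol_iXp : symbol_i ^+ p = a%:A.
Proof. by rewrite symbol_iX divnn p_gt0 expr1 modIp base1. Qed.

Lemma symbol_jXp : symbol_j ^+ p = b%:A.
Proof. by rewrite symbol_jX divnn p_gt0 expr1 modIp base1. Qed.

Lemma symbol_ij : symbol_i * symbol_j = omega *: (symbol_j * symbol_i).
Proof.
rewrite !baseM scalerA /coef /= !mod0n (modn_small p_gt1) !addn0 !add0n.
rewrite !(divn_small p_gt1) muln1 !expr0 expr1 invr1 !mulr1 divff ?(prim_root_eq0 omega_prim) -?lt0n //.
by congr (_ *: sc_base _); congr (_, _); apply: val_inj; rewrite /= addnC.
Qed.

Lemma symbol_algE (x : symbol_alg) :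
  x = \sum_(k : 'I_p * 'I_p) x k *: (symbol_i ^+ k.1 * symbol_j ^+ k.2).
Proof.
rewrite [LHS]sc_algE; apply: eq_bigr => -[r s] _; congr (_ *: _).
rewrite symbol_iX symbol_jX !divn_small // !scale1r baseM /coef /= !mod0n.
rewrite addn0 add0n !modn_small // !divn_small // mul0n expr0 invr1 !mulr1.
rewrite scale1r; congr sc_base; congr (_, _); apply: val_inj => /=;
  by rewrite ?mod0n ?addn0 ?add0n !modn_small.
Qed.

Lemma dim_symbol_alg : \dim {: symbol_alg} = (p ^ 2)%N.
Proof. by rewrite dim_sc_alg /= card_prod card_ord. Qed.

End SymbolAlgebra.

Definition alg_iso (K : fieldType) (A A' : falgType K) : Prop :=
  exists f : {lrmorphism A -> A'}, bijective f.

Definition is_division (K : fieldType) (A : falgType K) : Prop :=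
  forall x : A, x != 0 -> x \is a GRing.unit.

(* Two-sided ideals of a unital algebra are subspaces, hence the use of vspace. *)
Definition central_simple (K : fieldType) (B : falgType K) : Prop :=
  ('Z({:B}) = 1)%VS /\
  forall U : {vspace B}, ({:B} * U <= U)%VS -> (U * {:B} <= U)%VS ->
    (U = 0)%VS \/ (U = {:B})%VS.

Definition csa_of_degree (p : nat) (K : fieldType) (B : falgType K) : Prop :=
  central_simple B /\ \dim {:B} = (p ^ 2)%N.

Definition cyclic_ext_of_degree (p : nat) (F : fieldType)
    (S : splittingFieldType F) : Prop :=
  [/\ galois 1 {:S}, cyclic 'Gal({:S} / 1) & \dim {:S} = p].

(* B is of the form (S/F, sigma, c) = \bigoplus_(i < p) S x^i, the field S
   being embedded in B by f. *)
Definition is_cyclic_algebra (p : nat) (F : fieldType) (B : falgType F) : Prop :=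
  exists (S : splittingFieldType F) (sigma : gal_of {:S}) (c : F)
         (f : {lrmorphism S -> B}) (x : B),
    [/\ cyclic_ext_of_degree p S,
        'Gal({:S} / 1)%g = <[sigma]>%g,
        c != 0 /\ x ^+ p = c%:A,
        forall s : S, x * f s * x^-1 = f (sigma s)
      & forall y : B, exists! t : {ffun 'I_p -> S},
          y = \sum_(i < p) f (t i) * x ^+ i].

Section PowerClasses.
Variables (F : fieldType) (L : splittingFieldType F) (p : nat).
Local Notation H := 'Gal({:L} / 1)%g.

(* [x] = [y] in L^* / L^*p, for nonzero x and y. *)
Definition eq_pclass (x y : L) : Prop := exists2 d : L, d != 0 & x = y * d ^+ p.

Definition cyclotomic_char (alpha : gal_of {:L} -> {unit 'F_p}) : Prop :=
  forall h, h \in H -> forall z : L, z ^+ p = 1 ->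
    h z = z ^+ (val (alpha h) : 'F_p).

(* c lies in L^* and [c] in (L^* / L^*p)^(psi). *)
Definition eigenclass (psi : gal_of {:L} -> {unit 'F_p}) (c : L) : Prop :=
  c != 0 /\
  forall h, h \in H -> eq_pclass (h c) (c ^+ (val (psi h) : 'F_p)).

(* c lies in L^* and [c] in (L^* / L^*p)^H. *)
Definition fixedclass (c : L) : Prop :=
  c != 0 /\ forall h, h \in H -> eq_pclass (h c) c.

End PowerClasses.

(* Main.v *)
From HB Require Import structures.
From Stdlib Require Import Classical.
Require Import Defs.
From mathcomp Require Import all_boot all_algebra all_fingroup all_solvable.
From mathcomp Require Import all_field.

Set Implicit Arguments.
Unset Strict Implicit.
Unset Printing Implicit Defensive.

Import GRing.Theory.
Local Open Scope ring_scope.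

(* H is cyclic, of order n prime to p, generated by h.

   Existence of B: the eigenclass conditions make i |-> d i^k, j |-> e j^m an
   h-semilinear automorphism of A. Its n-th power multiplies i and j by p-th
   roots of unity, so a suitable power of it is h-semilinear of order n, and B
   is its fixed ring.

   B cyclic => A = (a',b'): in B (x) L, a Lagrange resolvent y of S satisfies
   y x = omega x y; it is nonzero by independence of automorphisms, normalizes
   a generating set, hence is a unit by simplicity. Then a' = y^p and b' = c;
   the conjugate of y under g in H is a scalar multiple of y^alpha(g).

   Converse, A a division algebra: take b' in F. Then A carries two h-semilinear
   automorphisms of order n, t with fixed ring B and t' with t'(j) = j. By
   Skolem-Noether t = Inn(g) t', and g t'(g) ... t'^(n-1)(g) = lam is in F.
   Determinants show that lam^(p^2) is a norm from L, and so is lam^n, so lam is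
   a norm; Hilbert 90 then gives v with v (fixed ring of t') v^-1 = B. The fixed
   ring of t' contains j and the fixed field S of t' in L(i), on which
   conjugation by j is an automorphism of order p.

   Converse, A not a division algebra: as p^2 divides n w only if it divides w,
   B is not a division algebra either, so it has a left ideal of dimension p and
   B = End_F(S) = (S,sigma,1) for any cyclic S of degree p. *)

(** * Independence of automorphisms and eigenvectors *)

(** Cyclic reindexing, which gives the invariance of traces and norms and the commutation rule of
    Lagrange resolvents. *)
Lemma big_ord_shift (R : Type) (idx : R) (op : Monoid.com_law idx) (G : nat -> R) p :
  G p = G 0%N -> \big[op/idx]_(l < p) G l.+1 = \big[op/idx]_(l < p) G l.
Proof.
by case: p => [|p] Gp; rewrite ?big_ord0 // big_ord_recr big_ord_recl Gp Monoid.mulmC.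
Qed.

(** Artin's argument: the relation at [s * k] minus [f (sg m k)] times the relation at [s] has no
    last term, and for a suitable [k] the factor [f (sg i k - sg m k)] is a unit because [S] is a
    field. The coefficients stay on the right, so [R] may be noncommutative. *)
Lemma dedekind_independence (S : fieldType) (R : unitRingType)
    (f : {rmorphism S -> R}) (sg : nat -> S -> S) (m : nat) (w : nat -> R) :
    (forall i, sg i 1 = 1) ->
    (forall i, {morph sg i : x y / x * y}) ->
    (forall i j, (i < j < m)%N -> exists s, sg i s != sg j s) ->
    (forall s, \sum_(i < m) f (sg i s) * w i = 0) ->
  forall i, (i < m)%N -> w i = 0.
Proof.
move=> sg1 sgM; elim: m w => // m IHm w sgd sum0.
have w0 i : (i < m)%N -> w i = 0.
  move=> lim; have [|k kP] := sgd i m; first by rewrite lim /=.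
  have Uk : f (sg i k - sg m k) \is a GRing.unit.
    by rewrite rmorph_unit ?unitfE ?subr_eq0.
  apply: (mulrI Uk); rewrite mulr0.
  apply: (IHm (fun i => f (sg i k - sg m k) * w i)) => // [i' j' /andP[ij jm]|s].
    by apply: sgd; rewrite ij ltnW.
  have := sum0 (s * k); rewrite big_ord_recr /=.
  have /(congr1 ( *%R (f (sg m k)))) := sum0 s.
  rewrite mulr0 big_ord_recr /= mulrDr => /addr0_eq e1 /addr0_eq e2.
  transitivity (\sum_(i0 < m) f (sg i0 (s * k)) * w i0
      - f (sg m k) * \sum_(i0 < m) f (sg i0 s) * w i0).
    rewrite mulr_sumr -sumrB; apply: eq_bigr => j _.
    by rewrite !mulrA -mulrBl -!rmorphM -rmorphB sgM mulrBr [sg m k * _]mulrC.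
  by rewrite e1 -[X in X + _]opprK e2 sgM [sg m s * _]mulrC rmorphM mulrA addNr.
move=> i; rewrite ltnS leq_eqVlt => /predU1P[->|/w0//].
have := sum0 1; rewrite big_ord_recr /= sg1 rmorph1 mul1r big1 ?add0r // => j _.
by rewrite w0 ?mulr0.
Qed.

Section Eigenvector.
Variables (K : fieldType) (p : nat) (omega : K).
Hypothesis omega_prim : p.-primitive_root omega.

(** The [zz u] are the projections of [z] to the eigenspaces of [th], up to the factor p. They add
    up to p times [z], and p is nonzero in [K] because [K] has a primitive p-th root of unity. The
    stable subspace [P] is a predicate, so that eigenvector conditions can be imposed one after the
    other. *)
Lemma exists_eigenvector (V : lmodType K) (th : V -> V) (P : V -> Prop) z :
    linear th -> (forall x, iter p th x = x) ->
    (forall a x y, P x -> P y -> P (a *: x + y)) ->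
    (forall x, P x -> P (th x)) -> z != 0 -> P z ->
  exists u z', [/\ z' != 0, P z' & th z' = omega ^+ u *: z'].
Proof.
move=> thL th_p PD Pth z0 Pz.
pose zz u := \sum_(l < p) (omega ^+ u) ^- l *: iter l th z.
have th0 : th 0 = 0 by apply: (addrI (th 0)); rewrite -{1}[th 0]scale1r -thL scaler0 !addr0.
have thZ a x : th (a *: x) = a *: th x by rewrite -[_ *: x]addr0 thL th0 addr0.
have thS (I : finType) (F : I -> V) : th (\sum_i F i) = \sum_i th (F i).
  by elim/big_rec2: _ => // i x y _ <-; rewrite -[F i]scale1r thL !scale1r.
have P0 : P 0 by rewrite -(addNr z) -scaleN1r; apply: PD.
have Piter l : P (iter l th z) by elim: l => //= l; apply: Pth.
have Pzz u : P (zz u).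
  by apply: big_ind => // [x y Px Py|l _]; [rewrite -[x]scale1r|rewrite -[_ *: _]addr0];
    apply: PD.
have wu0 u : omega ^+ u != 0.
  by rewrite expf_neq0 // (prim_root_eq0 omega_prim) -lt0n (prim_order_gt0 omega_prim).
have zzE u : th (zz u) = omega ^+ u *: zz u.
  pose F l := omega ^+ u *: ((omega ^+ u) ^- l *: iter l th z).
  have FE : th (zz u) = \sum_(l < p) F l.+1.
    rewrite thS; apply: eq_bigr => l _; rewrite thZ /F scalerA /=; congr (_ *: _).
    by rewrite exprS invfM mulrA divff // mul1r.
  have F0p : F p = F 0%N.
    rewrite /F th_p -exprM mulnC exprM (prim_expr_order omega_prim).
    by rewrite expr1n expr0 invr1.
  by rewrite FE scaler_sumr; exact: (big_ord_shift _ F0p).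
have : exists u : 'I_p, zz u != 0.
  apply/existsP; apply: contraNT z0; rewrite negb_exists => /forallP zz0.
  have : \sum_(u < p) zz u = 0.
    by apply: big1 => u _; apply/eqP; have := zz0 u; rewrite negbK.
  rewrite exchange_big /=.
  have p_gt0 := prim_order_gt0 omega_prim.
  (* After the exchange of sums, [l = 0] contributes p times [z]; every other [l] carries the sum of
     all powers of a p-th root of unity different from 1, which vanishes. *)
  rewrite (bigD1 (Ordinal p_gt0)) //= [X in _ + X]big1 => [|l l0].
    rewrite addr0 -scaler_suml; under eq_bigr do rewrite expr0 invr1.
    rewrite sumr_const card_ord => /eqP.
    by rewrite scaler_eq0 (negPf (prim_root_natf_neq0 omega_prim)).
  rewrite -scaler_suml; apply/eqP; rewrite scaler_eq0; apply/orP; left.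
  have wl1 : (omega ^- l) - 1 != 0.
    rewrite subr_eq0 -[1 in X in _ != X]invr1 (inj_eq invr_inj).
    rewrite -(prim_order_dvd omega_prim) gtnNdvd ?ltn_ord // lt0n.
    by apply: contraNneq l0 => l0; apply/eqP/val_inj.
  have wlp : (omega ^- l) ^+ p = 1.
    by rewrite exprVn -exprM mulnC exprM (prim_expr_order omega_prim) expr1n invr1.
  have := subrX1 (omega ^- l) p.
  rewrite wlp subrr => /esym/eqP; rewrite mulf_eq0 (negPf wl1) /= => /eqP sum0.
  rewrite -[X in _ == X]sum0; apply/eqP; apply: eq_bigr => u _.
  by rewrite -!exprVn -!exprM mulnC.
by case=> u uP; exists u, (zz u); split.
Qed.

End Eigenvector.

(** * Semilinear algebra morphisms and symbol algebras *)

(** One notion for three uses: [h = id] for algebra morphisms, [h] in a Galois group for semilinear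
    automorphisms, and [h = in_alg L] for maps from an F-algebra to an L-algebra. *)
Definition semimorph (K K' : nzRingType) (h : K -> K') (A : algType K)
    (A' : algType K') (f : A -> A') : Prop :=
  [/\ {morph f : x y / x + y}, forall k x, f (k *: x) = h k *: f x,
      {morph f : x y / x * y} & f 1 = 1].

Section Semimorph.
Variables (K K' K'' : nzRingType) (h : K -> K') (h' : K' -> K'').
Variables (A : algType K) (A' : algType K') (A'' : algType K'').
Variables (f : A -> A') (f' : A' -> A'').

Lemma semimorph0 : semimorph h f -> f 0 = 0.
Proof. by case=> fD _ _ _; apply: (addrI (f 0)); rewrite -fD !addr0. Qed.

Lemma semimorphX : semimorph h f -> forall x n, f (x ^+ n) = f x ^+ n.
Proof. by case=> _ _ fM f1 x; elim=> // n IHn; rewrite !exprS fM IHn. Qed.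

Lemma semimorphB : semimorph h f -> {morph f : x y / x - y}.
Proof.
move=> hf; have [fD _ _ _] := hf; move=> x y; rewrite fD; congr (_ + _).
by apply: (addrI (f y)); rewrite -fD !subrr semimorph0.
Qed.

Lemma semimorph_sum : semimorph h f ->
  forall (I : finType) (k : I -> K) (v : I -> A),
  f (\sum_i k i *: v i) = \sum_i h (k i) *: f (v i).
Proof.
move=> hf; have [fD fZ _ _] := hf => I k v.
by elim/big_rec2: _ => [|i x y _ <-]; rewrite ?semimorph0 // fD fZ.
Qed.

Lemma semimorph_alg : semimorph h f -> forall k, f k%:A = (h k)%:A.
Proof. by case=> _ fZ _ f1 k; rewrite fZ f1. Qed.

Lemma semimorph_comp : semimorph h f -> semimorph h' f' ->
  semimorph (h' \o h) (f' \o f).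
Proof.
move=> [fD fZ fM f1] [gD gZ gM g1].
by split=> [x y|k x|x y|] /=; rewrite ?fD ?gD ?fZ ?gZ ?fM ?gM ?f1 ?g1.
Qed.

Lemma eq_semimorph (h1 : K -> K') : h =1 h1 -> semimorph h f -> semimorph h1 f.
Proof. by move=> eh [fD fZ fM f1]; split=> // k x; rewrite fZ eh. Qed.

End Semimorph.

Lemma semimorph_iter (K : nzRingType) (h : K -> K) (A : algType K) (f : A -> A) n :
  semimorph h f -> semimorph (iter n h) (iter n f).
Proof.
by move=> hf; elim: n => [|n IHn] /=; [split | apply: semimorph_comp IHn hf].
Qed.

Lemma semimorph_inv (K : nzRingType) (A A' : algType K) (f : A -> A') (g : A' -> A) :
  semimorph id f -> cancel f g -> cancel g f -> semimorph id g.
Proof.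
move=> [fD fZ fM f1] fK gK.
split=> [x y|k x|x y|]; last by rewrite -f1 fK.
- by rewrite -{1}(gK x) -{1}(gK y) -fD fK.
- by rewrite -{1}(gK x) -fZ fK.
- by rewrite -{1}(gK x) -{1}(gK y) -fM fK.
Qed.

Lemma lrmorph_semimorph (K : nzRingType) (A A' : algType K) (f : {lrmorphism A -> A'}) :
  semimorph id f.
Proof.
split; [exact: rmorphD | exact: linearZZ | exact: rmorphM | exact: rmorph1].
Qed.

Lemma semimorph_lrmorph (K : nzRingType) (A A' : algType K) (f : A -> A') :
  semimorph id f -> exists g : {lrmorphism A -> A'}, g =1 f.
Proof.
case=> fD fZ fM f1.
have fL : linear f by move=> k x y; rewrite fD fZ.
pose a1 := GRing.isLinear.Build K A A' _ f fL.
pose a2 := GRing.isMonoidMorphism.Build A A' f (f1, fM).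
pose g : {lrmorphism A -> A'} := HB.pack f a1 a2.
by exists g.
Qed.

Lemma alg_isoI (K : fieldType) (A A' : falgType K) (f : A -> A') :
  semimorph id f -> bijective f -> alg_iso A A'.
Proof.
by move=> /semimorph_lrmorph[g gE] fb; exists g; apply: (eq_bij fb) => x; rewrite gE.
Qed.

Lemma alg_iso_sym (K : fieldType) (A A' : falgType K) : alg_iso A A' -> alg_iso A' A.
Proof.
case=> f [g fK gK]; apply: (@alg_isoI _ _ _ g); last by exists f.
exact: semimorph_inv (lrmorph_semimorph f) fK gK.
Qed.

Lemma alg_iso_trans (K : fieldType) (A A' A'' : falgType K) :
  alg_iso A A' -> alg_iso A' A'' -> alg_iso A A''.
Proof.
case=> f fb [g gb]; apply: (@alg_isoI _ _ _ (g \o f)); last exact: bij_comp.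
exact: semimorph_comp (lrmorph_semimorph f) (lrmorph_semimorph g).
Qed.

Lemma linear_inj_bij (K : fieldType) (V W : vectType K) (f : V -> W) :
  linear f -> (forall x, f x = 0 -> x = 0) -> \dim {:V} = \dim {:W} -> bijective f.
Proof.
move=> fL f0 dimE.
have [g gE] : exists g : {linear V -> W}, g =1 f.
  pose fLin := GRing.isLinear.Build K V W _ f fL.
  by exists (HB.pack f fLin : {linear V -> W}).
have gi : injective g.
  move=> x y /eqP; rewrite -subr_eq0 -linearB gE => /eqP/f0/eqP.
  by rewrite subr_eq0 => /eqP.
have lkg : lker (linfun g) == 0%VS by apply/lker0P => x y; rewrite !lfunE; apply: gi.
have img : limg (linfun g) = {:W}%VS.
  apply/eqP; rewrite eqEdim subvf -dimE limg_dim_eq ?leqnn //.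
  by rewrite (eqP lkg) capv0.
have gb : bijective g.
  apply: (Bijective (g := (linfun g)^-1%VF)) => x.
    by rewrite -[g x]lfunE lker0_lfunK.
  by rewrite -[LHS]lfunE limg_lfunVK // img memvf.
exact: (eq_bij gb).
Qed.

Lemma algr_unit (K : fieldType) (A : falgType K) (k : K) :
  k != 0 -> k%:A \is a @GRing.unit A.
Proof. by move=> k0; rewrite -in_algE rmorph_unit ?unitfE. Qed.

Lemma algr_inj (K : fieldType) (A : falgType K) : injective (fun k : K => k%:A : A).
Proof. exact: (fmorph_inj (in_alg A)). Qed.

Lemma algr_exp (K : fieldType) (A : falgType K) (k : K) n : (k%:A : A) ^+ n = (k ^+ n)%:A.
Proof. by rewrite -!in_algE rmorphXn. Qed.

Lemma semimorph_mulrl (K K' : nzRingType) (h : K -> K') (A : algType K)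
    (A' : algType K') (f : A -> A') : semimorph h f ->
  forall k x y u, f (k *: x + y) * u = h k *: (f x * u) + f y * u.
Proof. by case=> fD fZ _ _ k x y u; rewrite fD fZ mulrDl scalerAl. Qed.

(** * Elements that commute up to a scalar *)

Section SkewCommute.
Variables (K : fieldType) (A : algType K) (w : K) (x y : A).
Hypothesis xy : x * y = w *: (y * x).

Lemma skew_commX r s : x ^+ r * y ^+ s = w ^+ (r * s) *: (y ^+ s * x ^+ r).
Proof.
have xyX t : x * y ^+ t = w ^+ t *: (y ^+ t * x).
  elim: t => [|t IHt]; first by rewrite mulr1 mul1r scale1r.
  by rewrite !exprS mulrA xy -scalerAl -!mulrA IHt -scalerAr scalerA.
elim: r => [|r IHr]; first by rewrite mul1r mulr1 scale1r.
rewrite exprSr -mulrA xyX -scalerAr !mulrA IHr -scalerAl scalerA -exprD.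
by rewrite mulSn.
Qed.

End SkewCommute.

Section SkewInverse.
Variables (K : fieldType) (A : falgType K) (w : K).
Implicit Types x y z u : A.

Lemma unitr_monomial x y r s : x \is a GRing.unit -> y \is a GRing.unit ->
  x ^+ r * y ^+ s \is a GRing.unit.
Proof. by move=> Ux Uy; rewrite unitrMl unitrX. Qed.

Lemma skew_conj u v z : v \is a GRing.unit -> u * z * v^-1 = w *: z ->
  u * z = w *: (z * v).
Proof. by move=> Uv uz; rewrite -[LHS](mulrVK Uv) uz scalerAl. Qed.

Lemma skew_invl x y : y \is a GRing.unit -> x * y = w *: (y * x) ->
  y^-1 * x = w *: (x * y^-1).
Proof.
move=> Uy xy; apply: (mulrI Uy).
by rewrite (mulVKr Uy) -scalerAr mulrA scalerAl -xy (mulrK Uy).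
Qed.

Lemma skew_conj_comm x y z : y \is a GRing.unit -> x * y = w *: (y * x) ->
  z * x = x * z -> y * z * y^-1 * x = x * (y * z * y^-1).
Proof.
move=> Uy xy zx; rewrite !mulrA xy -!scalerAl -!mulrA (skew_invl Uy xy).
by rewrite -!scalerAr [z * (x * _)]mulrA zx !mulrA.
Qed.

Lemma skew_quotient_comm u y z : w != 0 -> z \is a GRing.unit ->
    y * u = w *: (u * y) -> z * u = w *: (u * z) ->
  u * (y * z^-1) = y * z^-1 * u.
Proof.
move=> w0 Uz yu zu; apply: (mulIr Uz).
rewrite mulrA (mulrVK Uz) -[RHS]mulrA.
have -> : u * z = w^-1 *: (z * u) by rewrite zu scalerA (mulVf w0) scale1r.
by rewrite -scalerAr mulrA (mulrVK Uz) yu scalerA (mulVf w0) scale1r.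
Qed.

End SkewInverse.

(** * Symbol algebras: simplicity, Skolem-Noether, universal property *)

Section SymbolTheory.
Variables (L : fieldType) (p : nat) (omega : L).
Hypothesis omega_prim : p.-primitive_root omega.
Hypothesis p_gt1 : (1 < p)%N.
Variables a b : L.
Hypotheses (a0 : a != 0) (b0 : b != 0).

Local Notation T := (symbol_alg omega_prim a b).
Local Notation si := (symbol_i omega_prim a b).
Local Notation sj := (symbol_j omega_prim a b).
Let iXp : si ^+ p = a%:A := symbol_iXp omega_prim a b p_gt1.
Let jXp : sj ^+ p = b%:A := symbol_jXp omega_prim a b p_gt1.
Let ijC : si * sj = omega *: (sj * si) := symbol_ij omega_prim a b p_gt1.
Let p_gt0 : (0 < p)%N := ltnW p_gt1.
Let w0 : omega != 0.
Proof. by rewrite (prim_root_eq0 omega_prim) -lt0n. Qed.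

Lemma symbol_baseE (k : 'I_p * 'I_p) :
  sc_base (D := symbol_table omega_prim a b) k = si ^+ k.1 * sj ^+ k.2.
Proof.
rewrite (symbol_algE p_gt1 (sc_base (D := symbol_table omega_prim a b) k)) (bigD1 k) //= !ffunE eqxx scale1r.
rewrite big1 ?addr0 // => l lk.
by rewrite !ffunE [k == l]eq_sym (negbTE lk) scale0r.
Qed.

Lemma symbol_coord (c : 'I_p * 'I_p -> L) k :
  (\sum_l c l *: (si ^+ l.1 * sj ^+ l.2)) k = c k.
Proof.
under eq_bigr do rewrite -symbol_baseE.
rewrite sum_ffunE (bigD1 k) //= !ffunE eqxx big1 ?addr0 => [|l lk].
  exact: mulr1.
by rewrite !ffunE (negbTE lk) scaler0.
Qed.

Lemma symbol_i_unit : si \is a GRing.unit.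
Proof. by rewrite -(unitrX_pos _ p_gt0) iXp algr_unit. Qed.

Lemma symbol_j_unit : sj \is a GRing.unit.
Proof. by rewrite -(unitrX_pos _ p_gt0) jXp algr_unit. Qed.

Lemma symbol_i_mono r s : si * (si ^+ r * sj ^+ s) = omega ^+ s *: (si ^+ r * sj ^+ s * si).
Proof.
have := skew_commX ijC 1 s; rewrite expr1 mul1n => e.
by rewrite mulrA -exprS exprSr -mulrA e -scalerAr mulrA.
Qed.

Lemma symbol_j_mono r s : sj * (si ^+ r * sj ^+ s) = omega ^- r *: (si ^+ r * sj ^+ s * sj).
Proof.
have := skew_commX ijC r 1; rewrite expr1 muln1 => e.
rewrite -mulrA -exprSr exprS [si ^+ r * (sj * _)]mulrA e -scalerAl scalerA.
by rewrite mulVf ?expf_neq0 // scale1r mulrA.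
Qed.

(** Conjugation by [si] multiplies the monomial with exponents (r, s) by [omega ^+ s], which differs
    from 1 for 0 < s < p. *)
Lemma symbol_cent_i (x : T) (k : 'I_p * 'I_p) :
  si * x = x * si -> k.2 != 0%N :> nat -> x k = 0.
Proof.
move=> ix k0.
have : \sum_(k : 'I_p * 'I_p) (x k * (omega ^+ k.2 - 1)) *: (si ^+ k.1 * sj ^+ k.2) = 0 :> T.
  apply: (mulIr symbol_i_unit); rewrite mul0r; transitivity (si * x - x * si); last by rewrite ix subrr.
  rewrite [in si * x](symbol_algE p_gt1 x) [in X in _ - X](symbol_algE p_gt1 x).
  rewrite mulr_sumr !mulr_suml -sumrB; apply: eq_bigr => l _.
  by rewrite -!scalerAl -scalerAr symbol_i_mono mulrBr mulr1 scalerBl scalerA.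
move/(congr1 (fun y : T => y k)); rewrite symbol_coord ffunE => /eqP.
rewrite mulf_eq0 => /orP[/eqP //|]; rewrite subr_eq0 -(prim_order_dvd omega_prim).
by rewrite gtnNdvd ?lt0n.
Qed.

Lemma symbol_cent_j (x : T) (k : 'I_p * 'I_p) :
  sj * x = x * sj -> k.1 != 0%N :> nat -> x k = 0.
Proof.
move=> jx k0.
have : \sum_(k : 'I_p * 'I_p) (x k * (omega ^- k.1 - 1)) *: (si ^+ k.1 * sj ^+ k.2) = 0 :> T.
  apply: (mulIr symbol_j_unit); rewrite mul0r; transitivity (sj * x - x * sj); last by rewrite jx subrr.
  rewrite [in sj * x](symbol_algE p_gt1 x) [in X in _ - X](symbol_algE p_gt1 x).
  rewrite mulr_sumr !mulr_suml -sumrB; apply: eq_bigr => l _.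
  by rewrite -!scalerAl -scalerAr symbol_j_mono mulrBr mulr1 scalerBl scalerA.
move/(congr1 (fun y : T => y k)); rewrite symbol_coord ffunE => /eqP.
rewrite mulf_eq0 => /orP[/eqP //|]; rewrite subr_eq0 -[1 in X in _ == X]invr1.
rewrite (inj_eq invr_inj) -(prim_order_dvd omega_prim).
by rewrite gtnNdvd ?lt0n.
Qed.

Lemma symbol_cent_ij (x : T) : si * x = x * si -> sj * x = x * sj -> exists l, x = l%:A.
Proof.
move=> ix jx; pose k0 : 'I_p * 'I_p := (Ordinal p_gt0, Ordinal p_gt0).
exists (x k0); rewrite [LHS](symbol_algE p_gt1) (bigD1 k0) //= mulr1 big1 ?addr0 //.
move=> [k1 k2] kk0; have [k20|k2n0] := eqVneq (k2 : nat) 0%N; last first.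
  by rewrite (symbol_cent_i ix) ?scale0r.
rewrite (symbol_cent_j jx) ?scale0r //=; apply: contraNneq kk0 => k10.
by apply/eqP; congr (_, _); apply: val_inj.
Qed.

Lemma symbol_gen_ind (P : T -> Prop) :
    (forall k x y, P x -> P y -> P (k *: x + y)) -> (forall x y, P x -> P y -> P (x * y)) ->
    P 1 -> P si -> P sj -> forall x, P x.
Proof.
move=> PD PM P1 Pi Pj x; have P0 : P 0 by rewrite -(addNr 1) -scaleN1r; apply: PD.
have PX n y : P y -> P (y ^+ n).
  by move=> Py; elim: n => // n IHn; rewrite exprS; apply: PM.
rewrite (symbol_algE p_gt1 x); apply: big_ind => // [y z Py Pz|k _].
  by rewrite -[y]scale1r; apply: PD.
by rewrite -[_ *: _]addr0; apply: PD => //; apply: PM; apply: PX.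
Qed.

(** The maps x |-> I x si^-1 and x |-> J x sj^-1 have p-th power the identity, and the second
    preserves the eigenspaces of the first. A common eigenvector in [P], multiplied by a monomial,
    has both eigenvalues 1. Letting [P] be an ideal gives simplicity; letting [P] be everything
    gives Skolem-Noether. *)
Lemma symbol_intertwiner (I J : T) (P : T -> Prop) z :
    I ^+ p = a%:A -> J ^+ p = b%:A -> I * J = omega *: (J * I) ->
    (forall k x y, P x -> P y -> P (k *: x + y)) ->
    (forall x y, P x -> P (y * x)) -> (forall x y, P x -> P (x * y)) ->
    z != 0 -> P z ->
  exists z', [/\ z' != 0, P z', I * z' = z' * si & J * z' = z' * sj].
Proof.
move=> IXp JXp IJ PD PMl PMr z0 Pz.
have Ui := symbol_i_unit; have Uj := symbol_j_unit.
have UI : I \is a GRing.unit by rewrite -(unitrX_pos _ p_gt0) IXp algr_unit.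
have conjL (u v : T) : linear (fun x => u * x * v).
  by move=> k x y; rewrite mulrDr mulrDl -scalerAr -scalerAl.
have conj_p (u v : T) c : c != 0 -> u ^+ p = c%:A -> v ^+ p = c%:A ->
    forall x, iter p (fun x => u * x * v^-1) x = x.
  move=> c0 uX vX x; have Uv : v \is a GRing.unit.
    by rewrite -(unitrX_pos _ p_gt0) vX algr_unit.
  have -> n : iter n (fun x => u * x * v^-1) x = u ^+ n * x * v ^- n.
    elim: n => [|n IHn] /=; first by rewrite mul1r invr1 mulr1.
    by rewrite IHn !exprS invrM ?unitrX // !mulrA.
  by rewrite uX vX mulr_algl -[c *: x]mulr_algr (mulrK (algr_unit T c0)).
have [u [z1 [z1n0 Pz1 z1E]]] := exists_eigenvector omega_prim (conjL I si^-1)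
  (conj_p _ _ _ a0 IXp iXp) PD (fun x Px => PMr _ si^-1 (PMl _ I Px)) z0 Pz.
pose P' x := P x /\ I * x = omega ^+ u *: (x * si).
have P'D k x y : P' x -> P' y -> P' (k *: x + y).
  move=> [Px xE] [Py yE]; split; first exact: PD.
  by rewrite mulrDr mulrDl -scalerAr -scalerAl xE yE scalerDr !scalerA mulrC.
have P'J x : P' x -> P' (J * x * sj^-1).
  move=> [Px xE]; split; first exact/PMr/PMl.
  have jVi := skew_invl Uj ijC.
  rewrite !mulrA IJ -!scalerAl -[J * I * x]mulrA xE -scalerAr -scalerAl scalerA.
  rewrite -!mulrA jVi -!scalerAr scalerA.
  by rewrite mulrC.
have P'z1 : P' z1.
  by split; [exact: Pz1 | exact: skew_conj Ui z1E].
have [v [z2 [z2n0 [Pz2 z2I] z2E]]] := exists_eigenvector omega_prim (conjL J sj^-1)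
  (conj_p _ _ _ b0 JXp jXp) P'D P'J z1n0 P'z1.
have z2J := skew_conj Uj z2E.
(* Moving [si] across [sj ^+ (p.-1 * u)] gives omega^((p-1)u), which cancels omega^u; moving [sj]
   across [si ^+ v] gives omega^(-v), which cancels omega^v. *)
pose m := si ^+ v * sj ^+ (p.-1 * u).
have Um : m \is a GRing.unit := unitr_monomial v _ Ui Uj.
exists (z2 * m); split; first by rewrite (mulIr_eq0 _ (mulIr Um)).
- exact: PMr.
- rewrite mulrA z2I -scalerAl -mulrA symbol_i_mono -scalerAr scalerA mulrA.
  rewrite -exprD -mulSn prednK // exprM (prim_expr_order omega_prim) expr1n.
  by rewrite scale1r.
- rewrite mulrA z2J -scalerAl -mulrA symbol_j_mono -scalerAr scalerA mulrA.
  by rewrite (mulfV (expf_neq0 v w0)) scale1r.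
Qed.

(** For [I = si] and [J = sj] the intertwiner is central, hence a nonzero scalar lying in the
    ideal. *)
Lemma symbol_simple (P : T -> Prop) x :
    (forall k x y, P x -> P y -> P (k *: x + y)) ->
    (forall x y, P x -> P (y * x)) -> (forall x y, P x -> P (x * y)) ->
  x != 0 -> P x -> P 1.
Proof.
move=> PD PMl PMr x0 Px.
have [z [z0 Pz zi zj]] := symbol_intertwiner iXp jXp ijC PD PMl PMr x0 Px.
have [l zE] := symbol_cent_ij zi zj.
have l0 : l != 0 by apply: contraNneq z0 => l0; rewrite zE l0 scale0r.
by rewrite -(mulVr (algr_unit T l0)) -zE; apply: PMl.
Qed.

(** The images of [si] and [sj] satisfy the defining relations, so an intertwiner exists; its
    property extends from the generators to all of [T]. It is only asserted to be nonzero, which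
    makes it invertible once the algebra is a division algebra. *)
Lemma symbol_skolem_noether (psi : T -> T) : semimorph id psi ->
  exists2 g, g != 0 & forall x, psi x * g = g * x.
Proof.
move=> psiH; have [psiD psiZ psiM psi1] := psiH.
have [| | |//|//|//|g [g0 _ gi gj]] :=
  @symbol_intertwiner (psi si) (psi sj) (fun=> True) 1 _ _ _ _ _ _ (oner_neq0 _) I.
- by rewrite -(semimorphX psiH) iXp (semimorph_alg psiH).
- by rewrite -(semimorphX psiH) jXp (semimorph_alg psiH).
- by rewrite -!psiM ijC psiZ.
exists g => // x.
apply: (symbol_gen_ind (P := fun x => psi x * g = g * x)) => // [k y z yE zE|y z yE zE|].
- by rewrite psiD psiZ mulrDl -scalerAl yE zE mulrDr scalerAr.
- by rewrite psiM -mulrA zE mulrA yE mulrA.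
- by rewrite psi1 mul1r mulr1.
Qed.

(** The universal property of the symbol presentation, relative to a field morphism [h], so that it
    yields semilinear maps as well as algebra morphisms. *)
Lemma symbol_universal (L' : fieldType) (h : {rmorphism L -> L'}) (C : algType L')
    (I J : C) :
    I ^+ p = (h a)%:A -> J ^+ p = (h b)%:A -> I * J = h omega *: (J * I) ->
  exists f : T -> C, [/\ semimorph h f, f si = I & f sj = J].
Proof.
move=> IXp JXp IJ.
pose f (x : T) := \sum_(k : 'I_p * 'I_p) h (x k) *: (I ^+ k.1 * J ^+ k.2).
have fD : {morph f : x y / x + y}.
  move=> x y; rewrite -big_split; apply: eq_bigr => k _ /=.
  by rewrite ffunE rmorphD scalerDl.
have fZ k x : f (k *: x) = h k *: f x.
  rewrite scaler_sumr; apply: eq_bigr => l _ /=.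
  by rewrite ffunE rmorphM scalerA.
(* A product of two basis monomials may have exponents p or more, so the formula is needed for all r
   and s. Reducing them modulo p produces the same powers of [a] and [b], up to [h], on both
   sides. *)
have fm r s : f (si ^+ r * sj ^+ s) = I ^+ r * J ^+ s.
  pose k0 : 'I_p * 'I_p := (Ordinal (ltn_pmod r p_gt0), Ordinal (ltn_pmod s p_gt0)).
  have expE (K : nzRingType) (A : algType K) (x : A) c n : x ^+ p = c%:A ->
      x ^+ n = c ^+ (n %/ p) *: x ^+ (n %% p).
    move=> xX; rewrite {1}(divn_eq n p) exprD mulnC exprM xX.
    have -> m : (c%:A : A) ^+ m = (c ^+ m)%:A.
      by elim: m => [|m IHm]; rewrite ?scale1r // !exprS IHm -scalerAl mul1r scalerA.
    by rewrite -scalerAl mul1r.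
  rewrite (expE _ _ si _ r iXp) (expE _ _ sj _ s jXp) (expE _ _ I _ r IXp).
  rewrite (expE _ _ J _ s JXp) -!scalerAl -!scalerAr !fZ !rmorphXn; congr (_ *: (_ *: _)).
  rewrite -[si ^+ _ * _](symbol_baseE k0) /f (bigD1 k0) //= !ffunE eqxx.
  rewrite big1 => [|k kk0]; first by rewrite rmorph1 scale1r addr0.
  by rewrite !ffunE [k0 == k]eq_sym (negbTE kk0) rmorph0 scale0r.
have f0 : f 0 = 0 by apply: (addrI (f 0)); rewrite -fD !addr0.
have fsum (c : 'I_p * 'I_p -> L) (v : 'I_p * 'I_p -> T) :
    f (\sum_k c k *: v k) = \sum_k h (c k) *: f (v k).
  by elim/big_rec2: _ => [|k x y _ <-]; rewrite ?f0 // fD fZ.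
have swap (K : fieldType) (A : algType K) (w : K) (x y : A) r s u v : w != 0 ->
    x * y = w *: (y * x) ->
    x ^+ r * y ^+ s * (x ^+ u * y ^+ v) = w ^- (u * s) *: (x ^+ (r + u) * y ^+ (s + v)).
  move=> wn0 xy; rewrite !exprD !mulrA -[_ * x ^+ u * y ^+ s]mulrA.
  rewrite (skew_commX xy u s) -!scalerAr -!scalerAl scalerA mulVf ?expf_neq0 //.
  by rewrite scale1r !mulrA.
have hw0 : h omega != 0 by rewrite fmorph_eq0.
have fM : {morph f : x y / x * y}.
  move=> x y; rewrite [in LHS](symbol_algE p_gt1 x) [in LHS](symbol_algE p_gt1 y).
  rewrite mulr_suml; under eq_bigr do rewrite -scalerAl.
  rewrite fsum [in RHS]/f mulr_suml; apply: eq_bigr => k _.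
  rewrite mulr_sumr; under eq_bigr do rewrite -scalerAr.
  rewrite fsum -scalerAl mulr_sumr; congr (_ *: _); apply: eq_bigr => l _.
  rewrite -scalerAr; congr (_ *: _).
  rewrite (swap _ _ _ _ _ _ _ _ _ w0 ijC) (swap _ _ _ _ _ _ _ _ _ hw0 IJ) fZ fm.
  by rewrite fmorphV rmorphXn.
have f1 : f 1 = 1.
  by have := fm 0%N 0%N; rewrite !expr0 !mulr1.
exists f; split=> //.
  by have := fm 1%N 0%N; rewrite !expr0 !expr1 !mulr1.
by have := fm 0%N 1%N; rewrite !expr0 !expr1 !mul1r.
Qed.

Lemma symbol_semimorph_eq (L' : fieldType) (h : L -> L') (C : algType L')
    (f g : T -> C) : semimorph h f -> semimorph h g -> f si = g si -> f sj = g sj ->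
  f =1 g.
Proof.
move=> hf hg fi fj x; rewrite (symbol_algE p_gt1 x).
rewrite (semimorph_sum hf) (semimorph_sum hg); apply: eq_bigr => k _.
have [_ _ fM _] := hf; have [_ _ gM _] := hg.
by rewrite fM gM !(semimorphX hf) !(semimorphX hg) fi fj.
Qed.

(** The kernel is a two-sided ideal without 1, hence zero; equality of dimensions does the rest. *)
Lemma symbol_hom_bij (C : falgType L) (f : T -> C) :
  semimorph id f -> \dim {:C} = (p ^ 2)%N -> bijective f.
Proof.
move=> hf dimC; have [fD fZ fM f1] := hf.
apply: linear_inj_bij; first by move=> k x y; rewrite fD fZ.
  move=> x fx; apply/eqP; apply: contraT => x0.
  have : f 1 = 0.
    apply: (symbol_simple (P := fun x => f x = 0) _ _ _ x0 fx) => [k y z y0 z0|y z y0|y z y0].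
    - by rewrite fD fZ y0 z0 scaler0 addr0.
    - by rewrite fM y0 mulr0.
    - by rewrite fM y0 mul0r.
  by rewrite f1 => /eqP; rewrite oner_eq0.
by rewrite dim_symbol_alg dimC.
Qed.

Lemma symbol_central_simple : central_simple T.
Proof.
split.
  apply/eqP; rewrite eqEsubv; apply/andP; split; last first.
    apply/subvP => _ /vlineP[k ->]; rewrite memv_cap memvf.
    by apply/centvP => x _; rewrite mulr_algl mulr_algr.
  apply/subvP => x; rewrite memv_cap => /andP[_ /centvP cx].
  have [||k ->] := @symbol_cent_ij x; rewrite ?cx ?memvf //.
  by rewrite memvZ // memv_line.
move=> U UM MU; have [[]|u0] := eqVneq U 0%VS; first by left.
right; apply/eqP; rewrite eqEsubv subvf; apply/subvP => x _; rewrite -[x]mul1r.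
apply: (prodvP MU) (memvf x).
apply: (symbol_simple (P := fun x => x \in U) (x := vpick U)).
- by move=> k y z yU zU; rewrite memvD // memvZ.
- by move=> y z yU; apply: (prodvP UM) => //; apply: memvf.
- by move=> y z yU; apply: (prodvP MU) => //; apply: memvf.
- by rewrite vpick0.
- exact: memv_pick.
Qed.

End SymbolTheory.

(** * Galois descent for a cyclic group *)

Lemma iter_morph1 (R : pzRingType) (f : {rmorphism R -> R}) n : iter n f 1 = 1.
Proof. by elim: n => //= n ->; rewrite rmorph1. Qed.

Lemma iter_morphM (R : pzRingType) (f : {rmorphism R -> R}) n : {morph iter n f : x y / x * y}.
Proof. by move=> x y; elim: n => //= n ->; rewrite rmorphM. Qed.

Section CyclicGalois.
Variables (F : fieldType) (E : splittingFieldType F) (s : gal_of {:E}).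

Lemma gal_expgE n x : (s ^+ n)%g x = iter n s x.
Proof.
elim: n => [|n IHn] /=; first by rewrite expg0 gal_id.
by rewrite expgSr galM ?memvf // IHn.
Qed.

Lemma iter_gal_order x : iter #[s]%g s x = x.
Proof. by rewrite -gal_expgE expg_order gal_id. Qed.

Lemma iter_gal_neq i k : (i < k < #[s]%g)%N -> exists x, iter i s x != iter k s x.
Proof.
case/andP=> ik ks.
have ne : (s ^+ i != s ^+ k)%g.
  by rewrite eq_expg_mod_order !modn_small ?(ltn_trans ik) // ltn_eqF.
have /lfunPn[x xP] : ahval (gal_repr (s ^+ i)%g) != ahval (gal_repr (s ^+ k)%g).
  by apply: contraNneq ne => e; apply/eqP/gal_repr_inj/val_inj.
by exists x; rewrite -!gal_expgE.
Qed.

Lemma gal_alg k : s (k%:A : E) = k%:A.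
Proof. by rewrite linearZ /= rmorph1. Qed.

Lemma gal_fixed_alg : galois 1 {:E} -> 'Gal({:E} / 1)%g = <[s]>%g ->
  forall x, s x = x -> exists k, x = k%:A.
Proof.
move=> /galois_fixedField gE sE x sx; apply/vlineP; rewrite -gE.
apply/fixedFieldP; first exact: memvf.
move=> t; rewrite sE => /cycleP[n ->]; rewrite gal_expgE.
by elim: n => //= n ->.
Qed.

End CyclicGalois.

Lemma span_ind (K : fieldType) (V : vectType K) (X : seq V) (P : V -> Prop) :
    P 0 -> (forall k x y, P x -> P y -> P (k *: x + y)) ->
    (forall x, x \in X -> P x) -> forall x, x \in <<X>>%VS -> P x.
Proof.
move=> P0 PD PX x /(@coord_span _ _ _ (in_tuple X)) ->.
apply: big_ind => // [y z Py Pz|k _]; first by rewrite -[y]scale1r; apply: PD.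
by rewrite -[_ *: _]addr0; apply: PD => //; apply/PX/mem_nth.
Qed.

Lemma exists_basis_subset (K : fieldType) (V : vectType K) (X : seq V) :
  exists Y, [/\ {subset Y <= X}, free Y & <<Y>>%VS = <<X>>%VS].
Proof.
elim: X => [|x X [Y [sYX Yf YX]]]; first by exists [::]; rewrite nil_free.
have [xX|xX] := boolP (x \in <<X>>%VS).
  exists Y; split=> // [y /sYX yX|]; first by rewrite inE yX orbT.
  by rewrite span_cons YX; apply/esym/addv_idPr; rewrite -memvE.
exists (x :: Y); split=> [y||]; last by rewrite !span_cons YX.
  by rewrite !inE => /predU1P[->|/sYX ->]; rewrite ?eqxx ?orbT.
by rewrite free_cons YX xX.
Qed.

Section Descent.
Variables (F : fieldType) (L : splittingFieldType F) (h : gal_of {:L}).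
Hypotheses (Lgal : galois 1 {:L}) (hgen : 'Gal({:L} / 1)%g = <[h]>%g).
Local Notation n := #[h]%g.

Section Vector.
Variables (V : vectType L) (rho : V -> V).
Hypotheses (rhoD : {morph rho : x y / x + y}) (rhoZ : forall k x, rho (k *: x) = h k *: rho x).
Hypothesis rho_n : forall x, iter n rho x = x.

(** The traces [Tr (l *: v)] are fixed by [rho], and they span [E] over [L]: a linear form that
    kills them all kills [E], by independence of the powers of [h]. *)
Lemma descent_basis (E : {vspace V}) : (forall x, x \in E -> rho x \in E) ->
  exists Y : seq V, basis_of E Y /\ (forall y, y \in Y -> rho y = y).
Proof.
move=> rhoE.
have rhoS (I : finType) (v : I -> V) : rho (\sum_i v i) = \sum_i rho (v i).
  have rho0 : rho 0 = 0 by apply: (addrI (rho 0)); rewrite -rhoD !addr0.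
  by elim/big_rec2: _ => // i x y _ <-.
pose Tr v := \sum_(l < n) iter l rho v.
have iterD l : {morph iter l rho : x y / x + y}.
  by elim: l => // l IHl x y /=; rewrite IHl rhoD.
have iterZ l k x : iter l rho (k *: x) = iter l h k *: iter l rho x.
  by elim: l => //= l ->; rewrite rhoZ.
have rhoTr v : rho (Tr v) = Tr v.
  by rewrite rhoS; apply: (big_ord_shift _ (G := fun l => iter l rho v)); apply: rho_n.
have TrE v : v \in E -> Tr v \in E.
  move=> vE; apply: memv_suml => l _; elim: (l : nat) => //= m.
  exact: rhoE.
have TrS (I : finType) (v : I -> V) : Tr (\sum_i v i) = \sum_i Tr (v i).
  have iter0 l : iter l rho 0 = 0 by apply: (addrI (iter l rho 0)); rewrite -iterD !addr0.
  rewrite exchange_big; apply: eq_bigr => l _.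
  by elim/big_rec2: _ => // i x y _ <-; rewrite iterD.
have TrZF (a : F) v : Tr (a%:A *: v) = a%:A *: Tr v.
  rewrite scaler_sumr; apply: eq_bigr => l _; rewrite iterZ; congr (_ *: _).
  by elim: (l : nat) => //= m ->; rewrite gal_alg.
(* A finite family is enough: [l |-> Tr (l *: v)] is F-linear, so letting [l] run over an F-basis of
   [L] captures all values. *)
pose X := [seq Tr (l *: e) | e <- vbasis E, l <- vbasis {:L}].
have [Y [sYX Yf YX]] := exists_basis_subset X.
exists Y; split=> [|y /sYX/allpairsP[[e l] [_ _ ->]]]; last exact: rhoTr.
rewrite /basis_of Yf andbT YX eqEsubv; apply/andP; split.
  apply/span_subvP => _ /allpairsP[[e l] [/= eE _ ->]].
  by rewrite TrE // memvZ // vbasis_mem.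
apply/subvP => v vE; rewrite (coord_vbasis vE); apply: memv_suml => e _; apply: memvZ.
move: (_`_e) (memt_nth 0 (vbasis E) (ltn_ord e)) => {v vE}v vE.
have TrX l : Tr (l *: v) \in <<X>>%VS.
  rewrite (coord_vbasis (memvf l)) scaler_suml.
  have -> : Tr (\sum_(r < \dim {:L}) (coord (vbasis {:L}) r l *: (vbasis {:L})`_r) *: v)
     = \sum_(r < \dim {:L}) (coord (vbasis {:L}) r l)%:A *: Tr ((vbasis {:L})`_r *: v).
    rewrite TrS; apply: eq_bigr => r _; rewrite -[in RHS]TrZF scalerA.
    by rewrite mulr_algl.
  apply: memv_suml => r _; rewrite memvZ // memv_span //.
  by apply/allpairsP; exists (v, (vbasis {:L})`_r); rewrite /= memt_nth.
(* [pr] has kernel the span of [X]. Each coordinate of [pr] is thus a linear form vanishing on all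
   traces of multiples of [v]; independence, read at the index 0, shows that it vanishes at [v]. *)
pose pr := (\1 - projv <<X>>)%VF.
have prE w : pr w = w - projv <<X>>%VS w by rewrite add_lfunE opp_lfunE id_lfunE.
have prK w : pr w = 0 -> w \in <<X>>%VS.
  by rewrite prE => /eqP; rewrite subr_eq0 => /eqP ->; apply: memv_proj.
have prX w : w \in <<X>>%VS -> pr w = 0.
  by move=> wX; rewrite prE projv_id // subrr.
apply: prK; rewrite (coord_vbasis (memvf (pr v))) big1 // => k _.
pose phi v : L := coord (vbasis {:V}) k (pr v).
have phi0 : phi 0 = 0 by rewrite /phi !linear0.
have phiD u v' : phi (u + v') = phi u + phi v' by rewrite /phi !linearD.
have phiZ l u : phi (l *: u) = l * phi u by rewrite /phi !linearZ.
suff -> : coord (vbasis {:V}) k (pr v) = 0 by rewrite scale0r.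
apply: (@dedekind_independence L L idfun (fun l => iter l h) n
  (fun l => phi (iter l rho v)) _ _ _ _ 0%N).
- exact: iter_morph1.
- exact: iter_morphM.
- exact: iter_gal_neq.
- move=> s; transitivity (phi (Tr (s *: v))); last by rewrite /phi prX // linear0.
  by rewrite /Tr; elim/big_rec2: _ => // l x y _ ->; rewrite phiD iterZ phiZ.
- exact: order_gt0.
Qed.

Lemma descent_nonzero : \dim {:V} != 0%N -> exists2 v, v != 0 & rho v = v.
Proof.
move=> dV; have [|Y [/andP[/eqP YE Yf] Yfix]] := descent_basis (E := fullv).
  by move=> x _; apply: memvf.
case: Y YE Yf Yfix => [|y Y] YE Yf Yfix.
  by rewrite -YE span_nil dimv0 eqxx in dV.
exists y; last by apply: Yfix; rewrite mem_head.
by apply: contraNneq (free_not0 Yf (mem_head y Y)) => ->.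
Qed.

End Vector.

(** [B] is the fixed ring of [tau] in the subalgebra [E], presented by structure constants in a
    basis of fixed vectors. It is used with [E] the whole algebra and with [E] the centralizer of
    the generator [symbol_i]; the last clause says that the fixed ring spans [E] over [L]. *)
Lemma algebra_descent (C : falgType L) (tau : C -> C) (E : {vspace C}) :
    semimorph h tau -> (forall x, iter n tau x = x) ->
    1 \in E -> {in E &, forall x y, x * y \in E} -> (forall x, x \in E -> tau x \in E) ->
  exists (B : falgType F) (g : B -> C),
    [/\ semimorph (in_alg L) g, injective g, \dim {:B} = \dim E,
        (forall b, g b \in E /\ tau (g b) = g b)
      & (forall x, x \in E -> tau x = x -> exists b, x = g b)
        /\ exists X : seq B, <<map g X>>%VS = E].
Proof.
move=> tauH tau_n E1 EM tauE; have [tauD tauZ tauM tau1] := tauH.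
have [Y [Yb Yfix]] := descent_basis tauD tauZ tau_n tauE.
have [/eqP YE Yf] := andP Yb.
pose d := size Y; pose y := in_tuple Y.
have yE k : (k < d)%N -> y`_k \in E by move=> kd; rewrite -YE memv_span // mem_nth.
have yfix (k : 'I_d) : tau y`_k = y`_k by apply: Yfix; rewrite mem_nth.
(* Applying [tau] to the expansion of a fixed element only applies [h] to its coordinates, so these
   are fixed by [h] and lie in [F]. In particular the structure constants do. *)
have coord_fix x k : x \in E -> tau x = x -> exists a : F, coord y k x = a%:A.
  move=> xE xfix; apply: (gal_fixed_alg Lgal hgen).
  have xS : x = \sum_(k < d) coord y k x *: y`_k by apply: coord_span; rewrite YE.
  have xS' : x = \sum_(r < d) h (coord y r x) *: y`_r.
    rewrite -[LHS]xfix [in tau x]xS (semimorph_sum tauH).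
    by apply: eq_bigr => r _; rewrite yfix.
  by have := congr1 (coord y k) xS'; rewrite coord_sum_free ?Yf // => <-.
have yM i k r : exists a : F, coord y r (y`_(i : 'I_d) * y`_(k : 'I_d)) = a%:A.
  by apply: coord_fix; rewrite ?EM ?yE // tauM !yfix.
have y1 r : exists a : F, coord y r 1 = a%:A by apply: coord_fix.
pose mul i k r : F := sval (sig_eqW (yM i k r)).
pose one r : F := sval (sig_eqW (y1 r)).
have mulE i k r : (mul i k r)%:A = coord y r (y`_i * y`_k) :> L.
  by rewrite /mul; case: sig_eqW => /= c ->.
have oneE r : (one r)%:A = coord y r 1 :> L.
  by rewrite /one; case: sig_eqW => /= c ->.
have inA : injective (fun c : F => c%:A : L) by apply: algr_inj.
have yS x : x \in E -> x = \sum_(r < d) coord y r x *: y`_r.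
  by move=> xE; apply: coord_span; rewrite YE.
have mulA i k r l : \sum_m mul k r m * mul i m l = \sum_m mul i k m * mul m r l.
  apply: inA => /=; rewrite -!in_algE !rmorph_sum /=.
  transitivity (coord y l (y`_i * (y`_k * y`_r))).
    rewrite [in RHS](yS (y`_k * _)) ?EM ?yE // mulr_sumr linear_sum /=.
    apply: eq_bigr => m _; rewrite -[LHS]in_algE rmorphM /= !mulE.
    by rewrite -scalerAr linearZ.
  rewrite mulrA [in LHS](yS (y`_i * _)) ?EM ?yE // mulr_suml linear_sum /=.
  apply: eq_bigr => m _; rewrite -[RHS]in_algE rmorphM /= !mulE.
  by rewrite -scalerAl linearZ.
have mul1l k r : \sum_i one i * mul i k r = (k == r)%:R.
  apply: inA => /=; rewrite -!in_algE !rmorph_sum rmorph_nat /=.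
  transitivity (coord y r (1 * y`_k)); last by rewrite mul1r coord_free // eq_sym.
  rewrite [in RHS](yS 1) // mulr_suml linear_sum /=.
  apply: eq_bigr => m _; rewrite -[LHS]in_algE rmorphM /= mulE oneE.
  by rewrite -scalerAl linearZ.
have mul1r' k r : \sum_i one i * mul k i r = (k == r)%:R.
  apply: inA => /=; rewrite -!in_algE !rmorph_sum rmorph_nat /=.
  transitivity (coord y r (y`_k * 1)); last by rewrite mulr1 coord_free // eq_sym.
  rewrite [in RHS](yS 1) // mulr_sumr linear_sum /=.
  apply: eq_bigr => m _; rewrite -[LHS]in_algE rmorphM /= mulE oneE.
  by rewrite -scalerAr linearZ.
have one_neq0 : exists i, one i != 0.
  apply/existsP; apply: contraNT (oner_neq0 C); rewrite negb_exists => /forallP e0.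
  rewrite [1](yS 1) // big1 // => r _; have := e0 r; rewrite negbK => /eqP e0r.
  by rewrite -oneE e0r scale0r scale0r.
pose D := SCTable mulA mul1l mul1r' one_neq0.
pose B : falgType F := sc_alg D.
pose g (b : B) : C := \sum_(r < d) in_alg L (b r) *: y`_r.
have gD : {morph g : u v / u + v}.
  move=> u v; rewrite -big_split; apply: eq_bigr => r _ /=.
  by rewrite ffunE !scalerDl.
have gZ c u : g (c *: u) = in_alg L c *: g u.
  rewrite scaler_sumr; apply: eq_bigr => r _ /=.
  by rewrite ffunE scalerA -!in_algE -rmorphM.
have gbase r : g (sc_base (D := D) r) = y`_r.
  rewrite /g (bigD1 r) //= !ffunE eqxx !scale1r big1 ?addr0 // => k kr.
  by rewrite !ffunE eq_sym (negbTE kr) !scale0r.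
have g0 : g 0 = 0 by apply: (addrI (g 0)); rewrite -gD !addr0.
have gS (c : 'I_d -> F) (v : 'I_d -> B) : g (\sum_r c r *: v r) = \sum_r in_alg L (c r) *: g (v r).
  by elim/big_rec2: _ => // r u v' _ <-; rewrite gD gZ.
have gM : {morph g : u v / u * v}.
  move=> u v; rewrite [in LHS](sc_algE u) [in LHS](sc_algE v) mulr_suml.
  under eq_bigr do rewrite -scalerAl.
  rewrite gS [in RHS]/g mulr_suml; apply: eq_bigr => i _.
  rewrite -scalerAl mulr_sumr; under [in LHS]eq_bigr do rewrite -scalerAr.
  rewrite gS mulr_sumr; congr (_ *: _); apply: eq_bigr => k _.
  rewrite -scalerAr; congr (_ *: _); rewrite sc_baseM gS.
  rewrite [RHS]yS ?EM ?yE //; apply: eq_bigr => r _.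
  by rewrite gbase -mulE.
have g1 : g 1 = 1.
  by rewrite [RHS]yS //; apply: eq_bigr => r _; rewrite ffunE -oneE.
exists B, g; split=> //.
- move=> u v uv; apply/ffunP => r; apply: inA => /=.
  have := congr1 (coord y r) uv.
  by rewrite !coord_sum_free.
- by rewrite dim_sc_alg card_ord -YE (eqP Yf).
- move=> b; split; first by apply: memv_suml => r _; rewrite memvZ // yE.
  rewrite (semimorph_sum tauH); apply: eq_bigr => r _.
  by rewrite gal_alg yfix.
split=> [x xE xfix|].
  have e r := coord_fix x r xE xfix.
  pose b : B := [ffun r => sval (sig_eqW (e r))].
  exists b; rewrite [LHS]yS //; apply: eq_bigr => r _.
  by rewrite ffunE; case: sig_eqW => /= c ->.
exists [seq sc_base (D := D) r | r <- enum 'I_d]; rewrite -[RHS]YE -map_comp.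
congr span; rewrite -[RHS](@mkseq_nth _ 0) /mkseq -val_enum_ord -map_comp.
by apply: eq_map => r; apply: gbase.
Qed.

End Descent.

(** * Central simple algebras and extension of scalars *)

Section FalgebraUnits.
Variables (K : fieldType) (A : falgType K).
Implicit Types x y z : A.

(** In finite dimension an injective right multiplication is surjective, so 1 is a left multiple of
    [y]. *)
Lemma falg_regular_unit y : (forall v, v * y = 0 -> v = 0) -> y \is a GRing.unit.
Proof.
move=> y0; have [|g gK Kg] := @linear_inj_bij K A A (fun v => v * y) _ y0 erefl.
  by move=> k u v; rewrite mulrDl scalerAl.
have gy : g 1 * y = 1 by rewrite Kg.
apply/unitrP; exists (g 1); split=> //; apply/eqP; rewrite -subr_eq0; apply/eqP/y0.
by rewrite mulrBl mul1r -mulrA gy mulr1 subrr.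
Qed.

Lemma falg_right_unit y z : y * z = 1 -> y \is a GRing.unit.
Proof.
by move=> yz; apply: falg_regular_unit => v vy; rewrite -[v]mulr1 -yz mulrA vy mul0r.
Qed.

(** The hypothesis makes the right ideal yA two-sided; being nonzero, it contains 1. *)
Lemma central_simple_normal_unit y : central_simple A -> y != 0 ->
  (forall c, exists c', c * y = y * c') -> y \is a GRing.unit.
Proof.
case=> _ simpleA y0 yN; pose U := (amull y @: {:A})%VS.
have memU z : reflect (exists c, z = y * c) (z \in U).
  apply: (iffP memv_imgP) => [[c _ ->]|[c ->]]; exists c; rewrite ?memvf ?lfunE //.
case: (simpleA U) => [||U0|UA].
- apply/prodvP => c _ _ /memU[z ->]; apply/memU; have [c' cE] := yN c.
  by exists (c' * z); rewrite !mulrA cE.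
- by apply/prodvP => _ c /memU[z ->] _; apply/memU; exists (z * c); rewrite mulrA.
- have : y \in U by apply/memU; exists 1; rewrite mulr1.
  by rewrite U0 memv0 (negbTE y0).
- have /memU[z] : 1 \in U by rewrite UA memvf.
  by move/esym/falg_right_unit.
Qed.

Lemma central_center x : central_simple A -> (forall c, c * x = x * c) ->
  exists k, x = k%:A.
Proof.
case=> centA _ xC; apply/vlineP; rewrite -centA memv_cap memvf.
by apply/centvP => c _; rewrite xC.
Qed.

End FalgebraUnits.

Lemma central_simple_iso (K : fieldType) (A A' : falgType K) :
  alg_iso A A' -> central_simple A -> central_simple A'.
Proof.
case=> f [g fK gK] [centA simpleA].
split.
  apply/eqP; rewrite eqEsubv; apply/andP; split; apply/subvP => x; last first.
    case/vlineP=> k ->; rewrite memv_cap memvf.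
    by apply/centvP => y _; rewrite mulr_algl mulr_algr.
  rewrite memv_cap => /andP[_ /centvP xC].
  have [||k gx] := @central_center _ A (g x).
  - by split.
  - by move=> c; apply: (can_inj fK); rewrite !rmorphM /= gK xC ?memvf.
  by rewrite -[x]gK gx rmorph_alg memvZ // memv_line.
move=> U UM MU; pose W := (linfun f @^-1: U)%VS.
have memW x : (x \in W) = (f x \in U) by rewrite -memv_preim lfunE.
case: (simpleA W) => [||W0|WA].
- apply/prodvP => c x _; rewrite !memW rmorphM => xU.
  by apply: (prodvP UM) => //; apply: memvf.
- apply/prodvP => x c; rewrite !memW rmorphM => xU _.
  by apply: (prodvP MU) => //; apply: memvf.
- left; apply/eqP; rewrite -subv0; apply/subvP => x xU.
  have : g x \in W by rewrite memW gK.
  by rewrite W0 !memv0 => /eqP gx; rewrite -[x]gK gx rmorph0.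
- right; apply/eqP; rewrite eqEsubv subvf; apply/subvP => x _.
  have : g x \in W by rewrite WA memvf.
  by rewrite memW gK.
Qed.

(** * Comparison of an algebra with its scalar extension *)

Section ExtScalars.
Variables (F : fieldType) (L : fieldExtType F) (B : falgType F).
Local Notation C := (ext_scalars B L).

Lemma tens_semimorph : semimorph (in_alg L) (fun b : B => tens b (1 : L) : C).
Proof.
split=> [x y|k x|x y|]; last exact: tens1.
- exact: (tensDl x y (1 : L)).
- by rewrite tensZ [RHS]scale_tens mulr1.
- by rewrite [RHS]tensM mulr1.
Qed.

Lemma tens_coord (b : B) (l : L) k : tens b l k = l * (coord (vbasis {:B}) k b)%:A.
Proof. by rewrite !ffunE. Qed.

Lemma tens_inj : injective (fun b : B => tens b (1 : L) : C).
Proof.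
move=> b b' e; rewrite (coord_vbasis (memvf b)) (coord_vbasis (memvf b')).
apply: eq_bigr => k _; congr (_ *: _); apply: (@algr_inj _ L).
by have := congr1 (fun x : C => x k) e; rewrite !tens_coord !mul1r.
Qed.

Lemma ext_scalars_ind (P : C -> Prop) :
  (forall k x y, P x -> P y -> P (k *: x + y)) -> (forall b, P (tens b (1 : L))) ->
  forall x, P x.
Proof.
move=> PD Pt x; have P0 : P 0 by rewrite -(addNr (tens 1 (1 : L))) -scaleN1r; apply: PD.
rewrite (ext_scalarsE x); apply: big_ind => // [y z Py Pz|k _].
  by rewrite -[y]scale1r; apply: PD.
by rewrite -[x k]mulr1 -scale_tens -[_ *: _]addr0; apply: PD.
Qed.

(** The universal property extends [g] to an L-linear map, which is onto because the image of [X]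
    spans, and then injective by dimension. *)
Lemma ext_scalars_iso (A : falgType L) (g : B -> A) (X : seq B) :
    semimorph (in_alg L) g -> \dim {:B} = \dim {:A} -> <<map g X>>%VS = fullv ->
  exists2 f : C -> A, semimorph id f & bijective f /\ forall b, f (tens b (1 : L)) = g b.
Proof.
case=> gD gZ gM g1 dimE gX.
have [f [[fL fM f1 fg] _]] := ext_scalars_univ gD gZ gM g1.
have fH : semimorph id f.
  have f0 : f 0 = 0 by apply: (addrI (f 0)); rewrite -{1}[f 0]scale1r -fL scaler0 !addr0.
  split=> [x y|k x||]; [| |exact: fM|exact: f1].
    by have := fL 1 x y; rewrite !scale1r.
  by have := fL k x 0; rewrite !addr0 f0 addr0.
exists f => //; split=> //; have [fl flE] := semimorph_lrmorph fH.
have img : limg (linfun fl) = {:A}%VS.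
  apply/eqP; rewrite eqEsubv subvf -gX; apply/span_subvP => _ /mapP[b _ ->].
  by apply/memv_imgP; exists (tens b (1 : L)); rewrite ?memvf // lfunE /= flE fg.
apply: linear_inj_bij => //; last by rewrite dim_ext_scalars.
have := limg_ker_dim (linfun fl) {:C}; rewrite img capfv -dimE dim_ext_scalars.
move/eqP; rewrite -{2}[\dim {:B}]add0n eqn_add2r dimv_eq0 => /eqP lk x fx.
by apply/eqP; rewrite -memv0 -lk memv_ker lfunE /= flE fx.
Qed.

(** A two-sided ideal of [B] spans one of [C] over [L], of no larger dimension, so it cannot span
    [C] without being all of [B]. *)
Lemma central_simple_descent : central_simple C -> central_simple B.
Proof.
move=> csC; have [tD tZ tM t1] := tens_semimorph; split.
  apply/eqP; rewrite eqEsubv; apply/andP; split; apply/subvP => z; last first.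
    case/vlineP=> k ->; rewrite memv_cap memvf.
    by apply/centvP => y _; rewrite mulr_algl mulr_algr.
  rewrite memv_cap => /andP[_ /centvP zC].
  have [|l zl] := @central_center _ C (tens z (1 : L)) csC.
    apply: ext_scalars_ind => [k x y xE yE|b].
      by rewrite mulrDl mulrDr -(scalerAl k x) -(scalerAr k _ x) xE yE.
    by rewrite -!tM zC ?memvf.
  have [k k0] : exists k, coord (vbasis {:B}) k 1 != 0.
    apply/existsP; apply: contraNT (oner_neq0 B); rewrite negb_exists => /forallP e0.
    rewrite (coord_vbasis (memvf 1)) big1 // => k _.
    by have := e0 k; rewrite negbK => /eqP ->; rewrite scale0r.
  (* The element [z] becomes a scalar [l] of [L]; comparing coordinates at an index where 1 has a
     nonzero one shows that [l] comes from [F]. *)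
  pose c := coord (vbasis {:B}) k z / coord (vbasis {:B}) k 1.
  have lE : l = c%:A.
    have := congr1 (fun x : C => x k) zl.
    rewrite -t1 scale_tens mulr1 !tens_coord mul1r => e.
    rewrite /c -in_algE rmorphM fmorphV /= e mulfK //.
    by rewrite -in_algE fmorph_eq0.
  have -> : z = c%:A by apply: tens_inj; rewrite /= tZ t1 in_algE -lE.
  by rewrite memvZ // memv_line.
move=> U UM MU; pose W := <<[seq tens u (1 : L) : C | u <- vbasis U]>>%VS.
have tW u : u \in U -> tens u (1 : L) \in W.
  move=> uU; rewrite (coord_vbasis uU) tens_sum memv_suml // => k _.
  by rewrite memvZ // memv_span //; apply/mapP; exists (vbasis U)`_k; rewrite ?memt_nth.
have Wind (P : C -> Prop) : (forall k x y, P x -> P y -> P (k *: x + y)) ->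
    (forall u, u \in U -> P (tens u (1 : L))) -> forall x, x \in W -> P x.
  move=> PD Pt; apply: span_ind => // [|_ /mapP[u uU ->]].
    by rewrite -(addNr (tens 0 (1 : L))) -scaleN1r; apply: (PD); apply/Pt/mem0v.
  exact/Pt/vbasis_mem.
case: (csC.2 W) => [||W0|WC].
- apply/prodvP => x w _ wW; move: x; apply: ext_scalars_ind => [k x y xW yW|b].
    by rewrite mulrDl -(scalerAl k x) memvD // memvZ.
  move: w wW; apply: Wind => [k x y xW yW|u uU].
    by rewrite mulrDr -(scalerAr k _ x) memvD // memvZ.
  by rewrite -tM tW // (prodvP UM) ?memvf.
- apply/prodvP => w x wW _; move: x; apply: ext_scalars_ind => [k x y xW yW|b].
    by rewrite mulrDr -(scalerAr k _ x) memvD // memvZ.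
  move: w wW; apply: Wind => [k x y xW yW|u uU].
    by rewrite mulrDl -(scalerAl k x) memvD // memvZ.
  by rewrite -tM tW // (prodvP MU) ?memvf.
- left; apply/eqP; rewrite -subv0; apply/subvP => u uU.
  have := tW u uU; rewrite W0 !memv0 => /eqP tu0.
  by apply/eqP/tens_inj; rewrite /= tu0 (semimorph0 tens_semimorph).
- right; apply/eqP; rewrite eqEdim subvf -(dim_ext_scalars B L) -WC.
  by rewrite (leq_trans (dim_span _)) // size_map size_tuple.
Qed.

End ExtScalars.

(** * Semilinear automorphisms of a symbol algebra *)

Section SymbolTwist.
Variables (F : fieldType) (L : splittingFieldType F) (h : gal_of {:L}).
Variables (p : nat) (omega : L).
Hypothesis omega_prim : p.-primitive_root omega.
Hypothesis p_gt1 : (1 < p)%N.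
Local Notation n := #[h]%g.
Hypothesis n_p : coprime n p.
Variables a b : L.
Hypotheses (a0 : a != 0) (b0 : b != 0).
Local Notation T := (symbol_alg omega_prim a b).
Local Notation si := (symbol_i omega_prim a b).
Local Notation sj := (symbol_j omega_prim a b).

Lemma iter_monomial (f : T -> T) (hL : L -> L) (x : T) (d : L) k :
    semimorph hL f -> f x = d *: x ^+ k ->
  forall l, exists c, iter l f x = c *: x ^+ (k ^ l).
Proof.
move=> fH fx; elim=> [|l [c IHl]]; first by exists 1; rewrite scale1r expr1.
exists (hL c * d ^+ (k ^ l)); rewrite /= IHl; have [_ fZ _ _] := fH.
by rewrite fZ (semimorphX fH) fx exprZn scalerA -exprM expnS.
Qed.

(* A monomial map whose n-th power is linear has order dividing n p: the n-th
   power multiplies x by a p-th root of unity. *)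
Lemma iter_monomial_id (f : T -> T) (x : T) (d c : L) k :
    semimorph h f -> f x = d *: x ^+ k -> x ^+ p = c%:A -> c != 0 ->
    k ^ n = 1 %[mod p] -> iter p (iter n f) x = x.
Proof.
move=> fH fx xX c0 kn.
have gH : semimorph id (iter n f).
  by apply: eq_semimorph (semimorph_iter n fH); apply: iter_gal_order.
have [e ge] := iter_monomial fH fx n.
have gx : exists e', iter n f x = e' *: x.
  exists (e * c ^+ (k ^ n %/ p)); rewrite ge {1}(divn_eq (k ^ n) p) kn modn_small //.
  by rewrite addn1 exprSr mulnC exprM xX algr_exp mulr_algl scalerA.
have [e' {}gx] := gx.
have ep : e' ^+ p = 1.
  have := semimorphX gH x p; rewrite xX (semimorph_alg gH) gx exprZn xX scalerA.
  by move/(@algr_inj _ T)/eqP; rewrite -{1}[c]mul1r eq_sym (inj_eq (mulIf c0)) => /eqP.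
have -> m : iter m (iter n f) x = e' ^+ m *: x.
  elim: m => [|m /= ->]; first by rewrite scale1r.
  by have [_ gZ _ _] := gH; rewrite gZ gx scalerA -exprSr.
by rewrite ep scale1r.
Qed.

(** The hypothesis on [h omega] is what the relation between [d *: si ^+ k] and [e *: sj ^+ m]
    requires. The last two clauses serve the division case: the powers of [tau] send [si] to
    monomials in [si], and [sj] can be kept fixed. *)
Lemma symbol_twist (k m : nat) (d e : L) :
    h a = a ^+ k * d ^+ p -> h b = b ^+ m * e ^+ p -> h omega = omega ^+ (k * m) ->
    k ^ n = 1 %[mod p] -> m ^ n = 1 %[mod p] ->
  exists tau : T -> T, [/\ semimorph h tau, forall x, iter n tau x = x,
    forall l, exists c r, iter l tau si = c *: si ^+ r
    & m = 1%N -> e = 1 -> tau sj = sj].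
Proof.
move=> ha hb hw kn mn.
have iXp : si ^+ p = a%:A := symbol_iXp omega_prim a b p_gt1.
have jXp : sj ^+ p = b%:A := symbol_jXp omega_prim a b p_gt1.
have [||| f [fH fi fj]] := @symbol_universal L p omega omega_prim p_gt1 a b L h T
  (d *: si ^+ k) (e *: sj ^+ m).
- by rewrite exprZn -exprM mulnC exprM iXp algr_exp scalerA mulrC -ha.
- by rewrite exprZn -exprM mulnC exprM jXp algr_exp scalerA mulrC -hb.
- rewrite /= hw -!scalerAl -!scalerAr (skew_commX (symbol_ij omega_prim a b p_gt1)).
  by rewrite !scalerA [d * e]mulrC; congr (_ *: _); rewrite [LHS]mulrC mulrA.
have fnp x : iter p (iter n f) x = x.
  have fnpH : semimorph id (iter p (iter n f)).
    apply: (eq_semimorph (h := iter p id)); first by elim: (p).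
    by apply/semimorph_iter/(eq_semimorph (iter_gal_order h))/semimorph_iter.
  apply: (symbol_semimorph_eq p_gt1 fnpH (g := id)).
  - by split.
  - exact: iter_monomial_id fH fi iXp a0 kn.
  - exact: iter_monomial_id fH fj jXp b0 mn.
(* Congruent to 1 modulo n, so that the q-th power of [f] is still h-semilinear, and to 0 modulo p,
   so that its n-th power is a power of the n p-th power of [f], which is the identity. *)
pose q := chinese n p 1 0.
have qp : (p %| q)%N by rewrite /dvdn chinese_modr // mod0n.
exists (iter q f); split.
- apply: eq_semimorph (semimorph_iter q fH) => x; rewrite -gal_expgE.
  congr ((_ : gal_of _) x); apply/eqP; rewrite -[X in _ == X]expg1 eq_expg_mod_order.
  by rewrite chinese_modl.
- move=> x; rewrite -iterM -(divnK qp) mulnC -mulnA iterM.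
  by elim: (q %/ p)%N => //= r ->; rewrite iterM fnp.
- move=> l; rewrite -iterM; have [c ->] := iter_monomial fH fi (l * q).
  by exists c, (k ^ (l * q))%N.
- by move=> m1 e1; elim: q {qp} => //= r ->; rewrite fj m1 e1 scale1r.
Qed.

End SymbolTwist.

(** * Existence of B *)

Lemma Fp_natr_mod (p m k : nat) : prime p -> m%:R = k%:R :> 'F_p -> m = k %[mod p].
Proof. by move=> pr /(congr1 val) /=; rewrite !val_Fp_nat. Qed.

Lemma Fp_natr_val (p : nat) (x : 'F_p) : (x : nat)%:R = x.
Proof. exact: natr_Zp. Qed.

(** * The cyclotomic extension and its Galois group *)

Section Cyclotomic.
Variables (p : nat) (F : fieldType) (L : splittingFieldType F) (omega : L).
Hypotheses (omega_prim : p.-primitive_root omega) (p_pr : prime p).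
Hypothesis L_omega : <<1; omega>>%VS = {:L}%VS.
Local Notation H := 'Gal({:L} / 1)%g.

(** [L] is the splitting field of X^p - 1, which is separable because p is nonzero in [L]. *)
Lemma cyclotomic_galois : galois 1 {:L}.
Proof.
apply/splitting_galoisField; exists ('X^p - 1); split.
- by rewrite rpredB ?rpredX ?polyOverX // rpred1.
- by rewrite separable_Xn_sub_1 // (prim_root_natf_neq0 omega_prim).
exists [seq omega ^+ i | i <- index_iota 0 p].
  by rewrite big_map (factor_Xn_sub_1 omega_prim) eqpxx.
apply/eqP; rewrite eqEsubv subvf /= -L_omega; apply/FadjoinP; split; first exact: sub1v.
rewrite seqv_sub_adjoin //; apply/mapP; exists 1%N; rewrite ?expr1 // mem_index_iota.
by rewrite prime_gt1.
Qed.

Variable alpha : {morphism H >-> {unit 'F_p}}.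
Hypothesis alpha_cyc : cyclotomic_char alpha.

Lemma cyclotomic_char_inj : ('injm alpha)%g.
Proof.
apply/subsetP => g gk; have gH := dom_ker gk; have ag := mker gk.
have gw : g omega = omega.
  by rewrite alpha_cyc ?(prim_expr_order omega_prim) // ag /= Fp_cast // modn_small ?prime_gt1.
rewrite inE; apply/gal_eqP => x _; rewrite gal_id.
have : x \in <<1; omega>>%VS by rewrite L_omega memvf.
have /subvP sub : (<<1; omega>> <= fixedSpace (gal_repr g))%VS.
  apply/FadjoinP; split; last by apply/fixedSpaceP.
  by apply/subvP => _ /vlineP[k ->]; apply/fixedSpaceP; rewrite gal_alg.
by move/sub/fixedSpaceP.
Qed.

(** [alpha] embeds the Galois group in the cyclic group of units of ['F_p], so its order divides p -
    1. *)
Lemma cyclotomic_generator :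
  exists h, [/\ h \in H, H = <[h]>%g & coprime #[h]%g p].
Proof.
have := field_unit_group_cyclic (alpha @* H)%G.
rewrite injm_cyclic ?cyclotomic_char_inj // => /cyclicP[h hE].
exists h; split=> //; first by rewrite hE cycle_id.
rewrite orderE -hE -(card_injm cyclotomic_char_inj) //.
have := cardSg (subsetT (alpha @* H)%g); rewrite card_finField_unit card_Fp // => dv.
apply: coprime_dvdl dv _; rewrite coprime_sym prime_coprime // gtnNdvd //.
  by rewrite -ltnS prednK ?prime_gt1 ?prime_gt0.
by rewrite prednK ?prime_gt0.
Qed.

Lemma char_val_exp (psi : {morphism H >-> {unit 'F_p}}) h : h \in H ->
  (val (psi h) : 'F_p) ^+ #[h]%g = 1.
Proof.
by move=> hH; rewrite -FinRing.val_unitX -morphX // expg_order morph1.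
Qed.

End Cyclotomic.

Section Existence.
Variables (p : nat) (F : fieldType) (L : splittingFieldType F) (omega : L).
Hypotheses (omega_prim : p.-primitive_root omega) (p_pr : prime p).
Hypothesis L_omega : <<1; omega>>%VS = {:L}%VS.
Local Notation H := 'Gal({:L} / 1)%g.
Variables alpha chi : {morphism H >-> {unit 'F_p}}.
Hypothesis alpha_cyc : cyclotomic_char alpha.

(** The exponents given by the two eigenclasses multiply to [alpha h], in agreement with the action
    of [h] on [omega]; so the twist exists, and descent applies to the whole algebra. *)
Lemma symbol_descends (a b : L) :
    eigenclass chi a -> eigenclass (fun h => (alpha h * (chi h)^-1)%g) b ->
  exists B : falgType F,
    csa_of_degree p B /\ alg_iso (ext_scalars B L) (symbol_alg omega_prim a b).
Proof.
move=> [a0 aE] [b0 bE]; have p_gt1 := prime_gt1 p_pr.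
have Lgal := cyclotomic_galois omega_prim p_pr L_omega.
have [h [hH hE n_p]] := cyclotomic_generator omega_prim p_pr L_omega alpha_cyc.
have [d d0 hd] := aE h hH; have [e e0 he] := bE h hH.
have [|| |tau [tauH tau_n _ _]] := symbol_twist omega_prim p_gt1 n_p a0 b0 hd he.
- rewrite alpha_cyc ?(prim_expr_order omega_prim) //; apply/eqP.
  rewrite (eq_prim_root_expr omega_prim); apply/eqP/Fp_natr_mod => //.
  rewrite natrM !Fp_natr_val.
  rewrite FinRing.val_unitM FinRing.val_unitV mulrC divfK //.
  by rewrite -unitfE (valP (chi h)).
- by apply: Fp_natr_mod => //; rewrite natrX Fp_natr_val char_val_exp.
- apply: Fp_natr_mod => //; rewrite natrX Fp_natr_val.
  by rewrite FinRing.val_unitM FinRing.val_unitV exprMn exprVn !char_val_exp // divr1.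
have [|||B [g [gH gi dB _ [_ [X XE]]]]] :=
  algebra_descent Lgal hE (E := fullv) tauH tau_n.
- exact: memvf.
- by move=> *; apply: memvf.
- by move=> *; apply: memvf.
have [f fH [fb _]] := ext_scalars_iso gH dB XE.
have iso := alg_isoI fH fb.
exists B; split=> //; split; last by rewrite dB dim_symbol_alg.
apply: (central_simple_descent (L := L)).
by apply: central_simple_iso (alg_iso_sym iso) _; apply: symbol_central_simple.
Qed.

End Existence.

(** * From cyclic algebras to symbol algebras *)

Lemma semimorph_rmorph (K K' : nzRingType) (h : K -> K') (A : algType K)
    (A' : algType K') (f : A -> A') :
  semimorph h f -> exists g : {rmorphism A -> A'}, g =1 f.
Proof.
move=> hf; have [fD fZ fM f1] := hf.
pose a1 := GRing.isZmodMorphism.Build A A' f (semimorphB hf).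
pose a2 := GRing.isMonoidMorphism.Build A A' f (f1, fM).
by exists (HB.pack f a1 a2 : {rmorphism A -> A'}).
Qed.

Section GaloisAction.
Variables (F : fieldType) (L : splittingFieldType F) (B : falgType F) (h : gal_of {:L}).
Local Notation C := (ext_scalars B L).

(** The map id (x) h: the basis vectors e_i (x) 1 are fixed, so it acts on coordinates. *)
Definition ext_scalars_gal (x : C) : C := [ffun k => h (x k)].

Lemma ext_scalars_gal_tens (b : B) (l : L) : ext_scalars_gal (tens b l) = tens b (h l).
Proof. by apply/ffunP => k; rewrite ffunE tens_coord [RHS]tens_coord rmorphM /= gal_alg. Qed.

Lemma ext_scalars_gal_semimorph : semimorph h ext_scalars_gal.
Proof.
split=> [x y|k x|x y|]; last by rewrite -{1}tens1 ext_scalars_gal_tens rmorph1 tens1.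
- by apply/ffunP => i; rewrite !ffunE rmorphD.
- by apply/ffunP => i; rewrite !ffunE rmorphM.
apply/ffunP => k; rewrite !ffunE rmorph_sum; apply: eq_bigr => i _.
rewrite rmorph_sum; apply: eq_bigr => j _.
by rewrite !rmorphM /= gal_alg !ffunE.
Qed.

Lemma ext_scalars_gal_fixed : galois 1 {:L} -> 'Gal({:L} / 1)%g = <[h]>%g ->
  forall x, ext_scalars_gal x = x -> exists b, x = tens b (1 : L).
Proof.
move=> Lgal hgen x xfix.
have xk k : exists a : F, x k = a%:A.
  by apply: (gal_fixed_alg Lgal hgen); rewrite -{2}xfix ffunE.
exists (\sum_k sval (sig_eqW (xk k)) *: (vbasis {:B})`_k).
rewrite [LHS]ext_scalarsE tens_sum; apply: eq_bigr => k _.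
by case: sig_eqW => /= a xa; rewrite scale_tens mulr1 xa.
Qed.

End GaloisAction.

Lemma cyclic_order (p : nat) (F : fieldType) (S : splittingFieldType F)
    (s : gal_of {:S}) :
  cyclic_ext_of_degree p S -> 'Gal({:S} / 1)%g = <[s]>%g -> #[s]%g = p.
Proof.
by case=> /galois_dim Sdim _ dimS sE; rewrite orderE -sE -Sdim dimS dimv1 divn1.
Qed.

Section CyclicAlgebra.
Variables (p : nat) (F : fieldType) (L : splittingFieldType F) (B : falgType F).
Variables (S : splittingFieldType F) (sg : gal_of {:S}) (f : {lrmorphism S -> B}) (x : B).
Hypothesis xf : forall s, x * f s = f (sg s) * x.
Hypothesis fx_span : forall y : B, exists t : 'I_p -> S, y = \sum_(i < p) f (t i) * x ^+ i.
Hypothesis sg_order : #[sg]%g = p.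
Local Notation C := (ext_scalars B L).
Local Notation X := (tens x (1 : L) : C).
Local Notation fC s := (tens (f s) (1 : L) : C).

Lemma cyclic_ext_ind (P : C -> Prop) :
    (forall k y z, P y -> P z -> P (k *: y + z)) ->
    (forall y z, P y -> P z -> P (y * z)) ->
    (forall s, P (fC s)) -> P X ->
  forall y, P y.
Proof.
move=> PD PM Pf PX; apply: ext_scalars_ind => // b.
have [tD tZ tM t1] := tens_semimorph L B.
have P1 : P 1 by move: (Pf 1); rewrite rmorph1 tens1.
have P0 : P 0 by rewrite -(addNr 1) -scaleN1r; apply: PD.
have [t ->] := fx_span b.
apply: (big_ind (fun b => P (tens b (1 : L)))) => [|u v Pu Pv|i _]; first by rewrite (semimorph0 (tens_semimorph L B)).
  by rewrite tD -[tens u _]scale1r; apply: PD.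
rewrite tM; apply: (PM) => //; rewrite (semimorphX (tens_semimorph L B)).
by elim: (i : nat) => // m IHm; rewrite exprS; apply: PM.
Qed.

(** The Lagrange resolvent, formed in the scalar extension, where [S] and [L] commute without lying
    in a common field. *)
Definition resolvent (w : L) (s : S) : C := \sum_(l < p) w ^+ l *: fC (iter l sg s).

(** Passing [X] through the sum shifts the powers of [sg] by one, hence the powers of [w] too. *)
Lemma resolvent_skew w s : w ^+ p = 1 -> resolvent w s * X = w *: (X * resolvent w s).
Proof.
move=> wp; have [tD tZ tM t1] := tens_semimorph L B.
rewrite mulr_sumr scaler_sumr.
transitivity (\sum_(l < p) w ^+ l.+1 *: (fC (iter l.+1 sg s) * X)).
  rewrite (big_ord_shift _ (G := fun l => w ^+ l *: (fC (iter l sg s) * X))).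
    by rewrite mulr_suml; apply: eq_bigr => l _; rewrite -(scalerAl _ (fC _)).
  by rewrite wp -{1}sg_order iter_gal_order.
apply: eq_bigr => l _; rewrite -(scalerAr _ X) scalerA -exprS; congr (_ *: _).
by rewrite -!tM /= -xf.
Qed.

Lemma resolvent_comm w s t : fC t * resolvent w s = resolvent w s * fC t.
Proof.
have [tD tZ tM t1] := tens_semimorph L B.
rewrite mulr_sumr mulr_suml; apply: eq_bigr => l _.
by rewrite -(scalerAr _ (fC t)) -(scalerAl _ (fC _)) -!tM -!rmorphM mulrC.
Qed.

(** If all resolvents vanished, the powers of [sg] would satisfy a linear relation whose coefficient
    at index 0 is 1. *)
Lemma resolvent_neq0 w : w != 0 -> (0 < p)%N -> exists s, resolvent w s != 0.
Proof.
move=> w0 p_gt0; apply: NNPP => all0.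
have fH := semimorph_comp (lrmorph_semimorph f) (tens_semimorph L B).
have [g gE] := semimorph_rmorph fH.
have : (w ^+ 0)%:A = 0 :> C.
  apply: (@dedekind_independence S C g (fun l => iter l sg) p (fun l => (w ^+ l)%:A) _ _ _ _ 0%N).
  - exact: iter_morph1.
  - exact: iter_morphM.
  - by rewrite -sg_order; apply: iter_gal_neq.
  - move=> s; transitivity (resolvent w s).
      by apply: eq_bigr => l _; rewrite gE mulr_algr.
    by apply/eqP; apply: contraT => rs; case: all0; exists s.
  - exact: p_gt0.
by rewrite scale1r => /eqP; rewrite oner_eq0.
Qed.

Lemma ext_scalars_gal_resolvent (g : gal_of {:L}) w s :
  ext_scalars_gal g (resolvent w s) = resolvent (g w) s.
Proof.
rewrite (semimorph_sum (ext_scalars_gal_semimorph B g)); apply: eq_bigr => l _.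
by rewrite rmorphXn ext_scalars_gal_tens rmorph1.
Qed.

End CyclicAlgebra.

Lemma cyclic_algebra_symbol (p : nat) (F : fieldType) (L : splittingFieldType F)
    (omega : L) (omega_prim : p.-primitive_root omega)
    (alpha : gal_of {:L} -> {unit 'F_p}) (B : falgType F) :
    (1 < p)%N -> cyclotomic_char alpha -> \dim {:B} = (p ^ 2)%N ->
    central_simple (ext_scalars B L) -> is_cyclic_algebra p B ->
  exists a' b' : L, [/\ eigenclass alpha a', fixedclass p b'
    & alg_iso (ext_scalars B L) (symbol_alg omega_prim a' b')].
Proof.
move=> p_gt1 alpha_cyc dimB csC [S [sg [c [f [x [Scyc sgE [c0 xp] xfx fx_exp]]]]]].
have p_gt0 := ltnW p_gt1.
have Ux : x \is a GRing.unit by rewrite -(unitrX_pos _ p_gt0) xp algr_unit.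
have xf s : x * f s = f (sg s) * x by rewrite -xfx mulrVK.
have fx_span (y : B) : exists t : 'I_p -> S, y = \sum_(i < p) f (t i) * x ^+ i.
  by have [t [tE _]] := fx_exp y; exists t.
have sg_order := cyclic_order Scyc sgE.
have w0 : omega != 0 by rewrite (prim_root_eq0 omega_prim) -lt0n.
have wp := prim_expr_order omega_prim.
pose X : ext_scalars B L := tens x 1.
pose fC s : ext_scalars B L := tens (f s) 1.
have tH := tens_semimorph L B; have [tD tZ tM t1] := tH.
(* [S] and [x] generate the algebra, so commuting with their images is enough to be a scalar. This
   yields both [a'] and, further on, [d]. *)
have centP z : (forall s, fC s * z = z * fC s) -> X * z = z * X -> exists k, z = k%:A.
  move=> fz Xz; apply: central_center => //.
  apply: (cyclic_ext_ind fx_span) => // [k u v uz vz|u v uz vz].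
    by rewrite mulrDl mulrDr -(scalerAl k u) -(scalerAr k z) uz vz.
  by rewrite -mulrA vz mulrA uz mulrA.
have [s ys0] := resolvent_neq0 f sg_order w0 p_gt0.
pose y := resolvent p sg f omega s.
have yX : y * X = omega *: (X * y) := resolvent_skew xf sg_order s wp.
have fy t : fC t * y = y * fC t by apply: resolvent_comm.
have Uy : y \is a GRing.unit.
  apply: central_simple_normal_unit => //.
  apply: (cyclic_ext_ind fx_span) => [k u v [u' uE] [v' vE]|u v [u' uE] [v' vE]|t|].
  - exists (k *: u' + v'); rewrite mulrDl mulrDr -(scalerAl k u) -(scalerAr k y).
    by rewrite uE vE.
  - by exists (u' * v'); rewrite -mulrA vE mulrA uE mulrA.
  - by exists (fC t); apply: fy.
  - exists (omega^-1 *: X); rewrite -(scalerAr _ y) yX scalerA mulVf //.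
    by rewrite scale1r.
have [a' ya] : exists a', y ^+ p = a'%:A.
  apply: centP => [t|]; first exact/commrX/fy.
  by have := skew_commX yX p 1; rewrite muln1 wp scale1r.
have a'0 : a' != 0.
  apply: contraTneq Uy => a'0; rewrite -(unitrX_pos _ p_gt0) ya a'0 scale0r.
  by rewrite unitr0.
pose b' : L := c%:A.
have b'0 : b' != 0 by rewrite /b' -in_algE fmorph_eq0.
have Xb : X ^+ p = b'%:A by rewrite -(semimorphX tH) xp (semimorph_alg tH).
exists a', b'; split.
- split=> // g gH; pose k : nat := (val (alpha g) : 'F_p).
  have gw : g omega = omega ^+ k by rewrite alpha_cyc.
  pose y' := resolvent p sg f (g omega) s.
  have gwp : g omega ^+ p = 1 by rewrite -rmorphXn /= wp rmorph1.
  have y'X : y' * X = omega ^+ k *: (X * y').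
    by rewrite -gw; apply: (resolvent_skew xf sg_order).
  have y'E : ext_scalars_gal g y = y' by apply: ext_scalars_gal_resolvent.
  have y'p : y' ^+ p = (g a')%:A.
    have gs := ext_scalars_gal_semimorph B g.
    by rewrite -y'E -(semimorphX gs) ya (semimorph_alg gs).
  have ykX : y ^+ k * X = omega ^+ k *: (X * y ^+ k).
    by have := skew_commX yX k 1; rewrite muln1 expr1.
  have Uyk : y ^+ k \is a GRing.unit by rewrite unitrX.
  (* [y'] and [y ^+ k] obey the same commutation rules with all generators, so their quotient is
     central. Taking p-th powers then compares [g a'] with [a' ^+ k]. *)
  have [d dE] : exists d, y' * y ^- k = d%:A.
    apply: centP => [t|].
      apply: (mulIr Uyk); rewrite -!mulrA mulVr // mulr1.
      have -> : fC t * y ^+ k = y ^+ k * fC t by apply/commrX/fy.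
      by rewrite mulKr //; apply: resolvent_comm.
    exact: skew_quotient_comm (expf_neq0 k w0) Uyk y'X ykX.
  have {}dE : y' = d *: y ^+ k by rewrite -mulr_algl -dE mulrVK.
  have ga : g a' = a' ^+ k * d ^+ p.
    apply: (@algr_inj _ (ext_scalars B L)); rewrite -y'p dE exprZn -exprM mulnC exprM.
    by rewrite ya algr_exp scalerA mulrC.
  exists d => //; apply: contraTneq a'0 => d0; rewrite negbK.
  by rewrite -(fmorph_eq0 g) /= ga d0 expr0n gtn_eqF // mulr0.
- split=> // g gH; exists 1; rewrite ?oner_neq0 //.
  by rewrite /b' gal_alg expr1n mulr1.
have [T [TH _ _]] := @symbol_universal L p omega omega_prim p_gt1 a' b' L idfun
  (ext_scalars B L) y X ya Xb yX.
apply: alg_iso_sym; apply: (alg_isoI TH).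
by apply: symbol_hom_bij => //; rewrite dim_ext_scalars.
Qed.

(** The direct sum decomposition comes for free: independence of the powers of [sg] makes [Lam]
    injective, and the dimensions agree. *)
Lemma is_cyclic_algebraI (p : nat) (F : fieldType) (B : falgType F)
    (S : splittingFieldType F) (sg : gal_of {:S}) (c : F) (f : {lrmorphism S -> B})
    (x : B) :
    (0 < p)%N -> \dim {:B} = (p ^ 2)%N -> cyclic_ext_of_degree p S ->
    'Gal({:S} / 1)%g = <[sg]>%g -> c != 0 -> x ^+ p = c%:A ->
    (forall s, x * f s = f (sg s) * x) ->
  is_cyclic_algebra p B.
Proof.
move=> p_gt0 dimB Scyc sgE c0 xp xf.
have Ux : x \is a GRing.unit by rewrite -(unitrX_pos _ p_gt0) xp algr_unit.
have sg_order := cyclic_order Scyc sgE.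
have xXf i s : x ^+ i * f s = f (iter i sg s) * x ^+ i.
  by elim: i => [|i IHi]; rewrite ?mulr1 ?mul1r // !exprS -mulrA IHi !mulrA xf.
pose Lam (t : {ffun 'I_p -> S}) := \sum_(i < p) f (t i) * x ^+ i.
have LamL : linear Lam.
  move=> k t u; rewrite scaler_sumr -big_split; apply: eq_bigr => i _ /=.
  by rewrite !ffunE linearP mulrDl scalerAl.
have Lam0 t : Lam t = 0 -> t = 0.
  (* The independence lemma takes a sequence indexed by [nat], so the coefficients are extended by 0
     beyond p. The relation it needs is [Lam t * f s = 0], with each [f s] moved to the left. *)
  move=> t0; pose w l : B := oapp (fun i : 'I_p => f (t i) * x ^+ i) 0 (insub l).
  have wE (i : 'I_p) : w i = f (t i) * x ^+ i by rewrite /w valK.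
  apply/ffunP => i; rewrite ffunE; apply: (fmorph_inj f); rewrite rmorph0.
  apply: (mulIr (unitrX i Ux)); rewrite mul0r -wE.
  apply: (@dedekind_independence S B f (fun l => iter l sg) p w).
  - exact: iter_morph1.
  - exact: iter_morphM.
  - by rewrite -sg_order; apply: iter_gal_neq.
  - move=> s; transitivity (Lam t * f s); last by rewrite t0 mul0r.
    rewrite mulr_suml; apply: eq_bigr => l _.
    by rewrite wE -mulrA xXf !mulrA -!rmorphM mulrC.
  - exact: ltn_ord.
have dimE : \dim {: {ffun 'I_p -> S}} = \dim {:B}.
  by rewrite dimB dimvf /dim /= card_ord; case: Scyc => _ _; rewrite dimvf => ->.
have [g gK Kg] := linear_inj_bij LamL Lam0 dimE.
exists S, sg, c, f, x; split=> // [s|y]; first by rewrite xf mulrK.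
exists (g y); split; first by rewrite -[LHS]Kg.
by move=> t ->; apply: gK.
Qed.

(** The matrix of the (l+1)-st iterate is the h-conjugate of that of the l-th times that of [rho];
    so the determinant of the n-th iterate is a product of conjugates of [del], the determinant of
    [rho] in a basis. *)
Lemma det_semilinear (K : fieldType) (V : vectType K) (h : {rmorphism K -> K})
    (rho : V -> V) (n : nat) (lam : K) :
    {morph rho : x y / x + y} -> (forall k x, rho (k *: x) = h k *: rho x) ->
    (forall x, iter n rho x = lam *: x) ->
  exists del, lam ^+ (\dim {:V}) = \prod_(l < n) iter l h del.
Proof.
move=> rhoD rhoZ rho_n; pose d := \dim {:V}; pose e := vbasis {:V}.
have rho0 : rho 0 = 0 by apply: (addrI (rho 0)); rewrite -rhoD !addr0.
have rhoS (k : 'I_d -> K) (v : 'I_d -> V) :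
    rho (\sum_i k i *: v i) = \sum_i h (k i) *: rho (v i).
  by elim/big_rec2: _ => [|i x y _ <-] //; rewrite rhoD rhoZ.
pose M l : 'M[K]_d := \matrix_(i, j) coord e j (iter l rho e`_i).
have ME l (i : 'I_d) : iter l rho e`_i = \sum_j M l i j *: e`_j.
  by rewrite [LHS](coord_vbasis (memvf _)); apply: eq_bigr => j _; rewrite mxE.
have MS l : M l.+1 = map_mx h (M l) *m M 1%N.
  apply/matrixP => i j; rewrite mxE /= ME rhoS.
  under eq_bigr => k _ do rewrite -[rho _]/(iter 1 rho _) ME scaler_sumr.
  rewrite exchange_big /=.
  under eq_bigr => k _ do under eq_bigr => l' _ do rewrite scalerA.
  under eq_bigr => k _ do rewrite -scaler_suml.
  rewrite coord_sum_free ?(basis_free (vbasisP _)) // [RHS]mxE.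
  by apply: eq_bigr => k _; rewrite [map_mx _ _ _ _]mxE.
have detM l : \det (M l.+1) = h (\det (M l)) * \det (M 1%N).
  by rewrite MS det_mulmx det_map_mx.
exists (\det (M 1%N)).
have -> : lam ^+ d = \det (M n).
  rewrite -det_scalar; congr (\det _); apply/matrixP => i j.
  rewrite !mxE rho_n linearZ /= coord_free ?(basis_free (vbasisP _)) //.
  by rewrite mulr_natr.
have M0 : \det (M 0%N) = 1.
  rewrite -(det1 _ d); congr (\det _); apply/matrixP => i j.
  by rewrite !mxE /= coord_free ?(basis_free (vbasisP _)) // eq_sym.
elim: {rho_n}n => [|l IHl]; first by rewrite M0 big_ord0.
rewrite detM IHl big_ord_recl /= mulrC rmorph_prod.
by congr (_ * _); apply: eq_bigr.
Qed.

(** * The split case *)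

(** Simplicity for ideals given as predicates, such as annihilators: the subspace AxA is a nonzero
    ideal contained in [P]. *)
Lemma central_simple_ideal (K : fieldType) (A : falgType K) (P : A -> Prop) x :
    central_simple A -> (forall k y z, P y -> P z -> P (k *: y + z)) ->
    (forall y z, P y -> P (z * y)) -> (forall y z, P y -> P (y * z)) ->
  x != 0 -> P x -> P 1.
Proof.
case=> _ simpleA PD Pl Pr x0 Px; pose U := ({:A} * <[x]> * {:A})%VS.
have P0 : P 0 by rewrite -(mul0r x); apply: Pl.
have UP y : y \in U -> P y.
  rewrite /U [@prodv _ _]unlock; apply: span_ind => // _ /allpairsP[[u v] [/= uU _ ->]].
  apply: Pr; move/vbasis_mem: uU.
  apply: span_ind => // _ /allpairsP[[u' v'] [/= _ /vbasis_mem/vlineP[k ->] ->]].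
  by rewrite -scalerAr scalerAl; apply: Pl.
have xU : x \in U by rewrite -[x]mulr1 -[x]mul1r !memv_mul ?memvf ?memv_line.
case: (simpleA U) => [||U0|UA].
- by rewrite !prodvA !prodvSl // subvf.
- by rewrite -prodvA prodvSr // subvf.
- by move: xU; rewrite U0 memv0 (negbTE x0).
- by apply: UP; rewrite UA memvf.
Qed.

(** [P] stands for being a submodule. Each [W] behaves as a simple or zero module: it lies in the
    partial sum already formed or meets it in 0, so every step adds 0 or [\dim W] to the
    dimension. *)
Lemma dvdn_dim_sum (K : fieldType) (V : vectType K) (P : {vspace V} -> Prop) (m : nat)
    (s : seq {vspace V}) :
    P 0%VS -> (forall U W, P U -> P W -> P (U + W)%VS) ->
    (forall W, W \in s -> [/\ P W, (m %| \dim W)%N &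
      forall U, P U -> (W <= U)%VS \/ (W :&: U = 0)%VS]) ->
  (m %| \dim (\sum_(W <- s) W)%VS)%N /\ P (\sum_(W <- s) W)%VS.
Proof.
move=> P0 PD; elim: s => [|W s IHs] sP; first by rewrite big_nil dimv0 dvdn0.
have [|IHd IHP] := IHs; first by move=> U Us; apply: sP; rewrite inE Us orbT.
have [PW dW WU] := sP W (mem_head W s); rewrite big_cons; split; last exact: PD.
have [/addv_idPr -> //|W0] := WU _ IHP.
by rewrite dimv_disjoint_sum // dvdn_add.
Qed.

(** * Division algebras under scalar extension of coprime degree *)

Section DivisionExtension.
Variables (F : fieldType) (L : fieldExtType F) (B : falgType F).
Local Notation C := (ext_scalars B L).
Hypothesis divB : is_division B.

(* A subspace U of C = B (x) L stable under B, seen as F-space, is a left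
   B-space, so its dimension over F is a multiple of that of B. *)
Lemma dvdn_dim_submodule (U : {vspace C}) :
    (forall b u, u \in U -> tens b (1 : L) * u \in U) ->
  (\dim {:B} %| \dim U * \dim {:L})%N.
Proof.
(* Coordinates identify the L-space [U] with [V], a vector space over [F] of dimension
   [\dim U * \dim {:L}], to which the action of [B] is transported. *)
move=> UB; pose w := \dim U; pose V := {ffun 'I_w -> L}.
have [tD tZ tM t1] := tens_semimorph L B.
pose phi (t : V) : C := \sum_(r < w) t r *: (vbasis U)`_r.
pose psi (x : C) : V := [ffun r => coord (vbasis U) r x].
have phiU t : phi t \in U by apply: memv_suml => r _; rewrite memvZ // vbasis_mem // memt_nth.
have phiK x : x \in U -> phi (psi x) = x.
  by move=> xU; rewrite [RHS](coord_vbasis xU); apply: eq_bigr => r _; rewrite ffunE.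
have psiK t : psi (phi t) = t.
  by apply/ffunP => r; rewrite ffunE coord_sum_free // (basis_free (vbasisP _)).
pose act (b : B) (t : V) : V := psi (tens b (1 : L) * phi t).
have phi_act b t : phi (act b t) = tens b (1 : L) * phi t by rewrite phiK ?UB.
have actM b b' t : act (b * b') t = act b (act b' t).
  by rewrite /act phiK ?UB // tM mulrA.
have act1 t : act 1 t = t by rewrite /act t1 mul1r psiK.
have actL t : linear (act^~ t).
  move=> k b b'; apply/ffunP => r; rewrite 3!ffunE.
  rewrite (semimorph_mulrl (tens_semimorph L B)) linearD linearZ /=.
  by rewrite mulr_algl !ffunE.
have [M ME] : exists M : V -> {linear B -> V}, forall t b, M t b = act b t.
  by exists (fun t => HB.pack_for {linear B -> V} (act^~ t)
    (GRing.isLinear.Build F B V _ _ (actL t))).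
have memM t v : reflect (exists b, v = act b t) (v \in limg (linfun (M t))).
  apply: (iffP memv_imgP) => [[b _ ->]|[b ->]]; exists b; by rewrite ?memvf // lfunE /= ME.
pose P (W : {vspace V}) := forall b t, t \in W -> act b t \in W.
have actD b : {morph act b : t u / t + u}.
  move=> t u; apply/ffunP => r; rewrite !ffunE -linearD -mulrDr; congr (coord _ _ (_ * _)).
  by rewrite -big_split; apply: eq_bigr => i _; rewrite ffunE scalerDl.
have act0 b : act b 0 = 0 by apply: (addrI (act b 0)); rewrite -actD !addr0.
have actZ k b t : act (k *: b) t = k *: act b t.
  by rewrite -!ME linearZ.
have act0l t : act 0 t = 0 by rewrite -ME linear0.
have actI b t : act b t = 0 -> b != 0 -> t = 0.
  by move=> bt b0; rewrite -[t]act1 -(mulVr (divB b0)) actM bt act0.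
(* The submodules B t, for t in a basis of [V], add up to [V]. Each is simple of dimension
   [\dim {:B}], since nonzero elements of [B] are invertible. *)
have [|||d _] := @dvdn_dim_sum F V P (\dim {:B}) [seq limg (linfun (M t)) | t <- vbasis {:V}].
- by move=> b t; rewrite memv0 => /eqP ->; rewrite act0 memv0.
- move=> W W' PW PW' b t /memv_addP[u uW [v vW ->]].
  by rewrite actD memv_add ?PW ?PW'.
- move=> _ /mapP[t tV ->].
  have t0 : t != 0 := basis_not0 (vbasisP _) tV.
  split=> [b v /memM[b' ->]||U' PU'].
  + by apply/memM; exists (b * b'); rewrite actM.
  + rewrite limg_dim_eq // capfv; apply/eqP/lker0P => b b' /eqP.
    rewrite !lfunE /= -subr_eq0 -linearB ME => /eqP bt.
    by apply/eqP; rewrite -subr_eq0; apply: contraT => /(actI _ _ bt)/eqP; rewrite (negbTE t0).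
  have [->|] := eqVneq (limg (linfun (M t)) :&: U')%VS 0%VS; first by right.
  rewrite -vpick0 => v0; left; move: (memv_pick (limg (linfun (M t)) :&: U')%VS).
  rewrite memv_cap => /andP[/memM[b bE]]; rewrite bE => btU.
  have b0 : b != 0 by apply: contraNneq v0 => b0; rewrite bE b0 act0l.
  apply/subvP => _ /memM[b' ->]; rewrite -[t]act1 -(mulVr (divB b0)) actM.
  exact: (PU' _ _ (PU' _ _ btU)).
have -> : (\dim U * \dim {:L})%N = \dim {:V}.
  by rewrite [RHS]dimvf /dim /= card_ord -dimvf.
suff -> : {:V}%VS = (\sum_(W <- [seq limg (linfun (M t)) | t <- vbasis {:V}]) W)%VS by [].
apply/eqP; rewrite eqEsubv subvf andbT; apply/subvP => v _.
rewrite (coord_vbasis (memvf v)) big_map; apply: memv_suml => r _; apply: memvZ.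
have rV : (vbasis {:V})`_r \in vbasis {:V} by apply: memt_nth.
rewrite (big_rem _ rV) /=; apply: (subvP (addvSl _ _)).
by apply/memM; exists 1; rewrite act1.
Qed.

(** The left annihilator of [x] is stable under [B], so by coprimality its dimension is a multiple
    of [\dim {:B}]: it is 0 or everything, and the latter would give [x = 0]. *)
Lemma division_ext_scalars : coprime (\dim {:L}) (\dim {:B}) -> is_division C.
Proof.
move=> co x x0; apply: falg_regular_unit => v vx.
pose U := lker (amulr x).
have memU u : (u \in U) = (u * x == 0) by rewrite memv_ker lfunE.
have : (\dim {:B} %| \dim U * \dim {:L})%N.
  apply: dvdn_dim_submodule => b u; rewrite !memU => /eqP ux.
  by rewrite -mulrA ux mulr0.
rewrite Gauss_dvdl 1?coprime_sym // -(dim_ext_scalars B L).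
have [/eqP|U0 dv] := posnP (\dim U).
  by rewrite dimv_eq0 => /eqP U0 _; apply/eqP; rewrite -memv0 -U0 memU vx.
have : U = fullv by apply/eqP; rewrite eqEdim subvf dvdn_leq.
move=> UC; have := memvf (1 : C); rewrite -UC memU mul1r.
by rewrite (negbTE x0).
Qed.

End DivisionExtension.

Lemma exists_min_nat (T : Type) (P : T -> Prop) (m : T -> nat) :
  (exists x, P x) -> exists2 x, P x & forall y, P y -> (m x <= m y)%N.
Proof.
case=> x0 Px0; apply: NNPP => none.
have all k x : (m x < k)%N -> ~ P x.
  elim: k x => // k IHk x; rewrite ltnS => xk Px; apply: none; exists x => // y Py.
  by rewrite leqNgt; apply/negP => yx; apply: (IHk y) Py; apply: leq_trans yx xk.
exact: (all (m x0).+1 x0 (ltnSn _) Px0).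
Qed.

(** * Minimal left ideals in prime degree *)

Section MinimalLeftIdeal.
Variables (p : nat) (K : fieldType) (A : falgType K).
Hypotheses (p_pr : prime p) (csA : central_simple A) (dimA : \dim {:A} = (p ^ 2)%N).
Let lideal (U : {vspace A}) := forall c u, u \in U -> c * u \in U.

(** A nonzero [x] with Ax of least dimension makes W = Ax a minimal left ideal. By simplicity WA =
    A, so A is a sum of translates Wc, each zero or of dimension [\dim W]; hence [\dim W] divides
    p^2. *)
Lemma exists_left_ideal : ~ is_division A ->
  exists W : {vspace A}, \dim W = p /\ forall c u, u \in W -> c * u \in W.
Proof.
move=> ndivA; pose Ax x := limg (amulr x : 'End(A)).
have memAx x y : reflect (exists c, y = c * x) (y \in Ax x).
  by apply: (iffP memv_imgP) => [[c _ ->]|[c ->]]; exists c; rewrite ?memvf ?lfunE.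
have Ax_id x : x \in Ax x by apply/memAx; exists 1; rewrite mul1r.
have Axl x : lideal (Ax x).
  by move=> c _ /memAx[d ->]; apply/memAx; exists (c * d); rewrite mulrA.
have [x0 [x0n0 x0nu]] : exists x0 : A, x0 != 0 /\ x0 \isn't a GRing.unit.
  apply: NNPP => none; apply: ndivA => x xn0; apply: contraT => xnu.
  by case: none; exists x.
have [x xn0 xmin] := @exists_min_nat A (fun x => x != 0) (fun x => \dim (Ax x))
  (ex_intro _ x0 x0n0).
pose W := Ax x; exists W; split; last exact: Axl.
have Wmin I : lideal I -> (I <= W)%VS -> I = 0%VS \/ I = W.
  move=> lI IW; have [->|] := eqVneq I 0%VS; [by left | rewrite -vpick0 => I0; right].
  have vI := memv_pick I.
  apply/eqP; rewrite eqEdim IW (leq_trans (xmin _ I0)) // dimvS //.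
  by apply/subvP => _ /memAx[c ->]; apply: lI.
pose Wc c := (amulr c @: W)%VS.
have memWc c y : reflect (exists2 u, u \in W & y = u * c) (y \in Wc c).
  by apply: (iffP memv_imgP) => [[u uW ->]|[u uW ->]]; exists u; rewrite ?lfunE.
have [|U V lU lV||dW _] := @dvdn_dim_sum K A lideal (\dim W) [seq Wc c | c <- vbasis {:A}].
- by move=> c u; rewrite memv0 => /eqP ->; rewrite mulr0 mem0v.
- move=> c _ /memv_addP[u uU [v vV ->]].
  by rewrite mulrDr memv_add ?lU ?lV.
- move=> _ /mapP[c _ ->]; split.
  + by move=> d _ /memWc[u uW ->]; apply/memWc; exists (d * u); rewrite ?mulrA // Axl.
  + have [||e|e] := Wmin (W :&: lker (amulr c))%VS.
    * move=> d u; rewrite !memv_cap !memv_ker !lfunE => /andP[uW /= /eqP uc].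
      by rewrite Axl //= -mulrA uc mulr0 eqxx.
    * exact: capvSl.
    * by rewrite /Wc limg_dim_eq ?dvdnn.
    * have := limg_ker_dim (amulr c) W; rewrite e -[X in _ = X]addn0 => /addnI ->.
      exact: dvdn0.
  + move=> U lU; have [||e|e] := Wmin (W :&: (amulr c @^-1: U))%VS.
    * move=> d u; rewrite !memv_cap -!memv_preim !lfunE => /andP[uW /= ucU].
      by rewrite Axl //= -mulrA lU.
    * exact: capvSl.
    * right; apply/eqP; rewrite -subv0; apply/subvP => y.
      rewrite memv_cap => /andP[/memWc[u uW ->] ucU].
      have : u \in (W :&: (amulr c @^-1: U))%VS.
        by rewrite memv_cap uW -memv_preim lfunE.
      by rewrite e memv0 => /eqP ->; rewrite mul0r mem0v.
    * left; apply/subvP => y /memWc[u uW ->].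
      by move: uW; rewrite -e memv_cap -memv_preim lfunE => /andP[].
have WA : (W * {:A})%VS = {:A}%VS.
  have [||W0|//] := csA.2 (W * {:A})%VS.
  - by rewrite prodvA prodvSl //; apply/prodvP => c u _; apply: Axl.
  - by rewrite -prodvA prodvSr // subvf.
  - have := memv_mul (Ax_id x) (memvf 1).
    by rewrite -/W W0 mulr1 memv0 (negbTE xn0).
have sumE : (\sum_(U <- [seq Wc c | c <- vbasis {:A}]) U)%VS = {:A}%VS.
  apply/eqP; rewrite eqEsubv subvf -{1}WA; apply/prodvP => u c uW _.
  rewrite (coord_vbasis (memvf c)) mulr_sumr big_map memv_suml // => r _.
  rewrite -scalerAr memvZ //.
  have rA : (vbasis {:A})`_r \in vbasis {:A} by apply: memt_nth.
  rewrite (big_rem _ rA) /=; apply: (subvP (addvSl _ _)).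
  by apply/memWc; exists u.
rewrite sumE dimA in dW.
have W_lt : (\dim W < p ^ 2)%N.
  apply: leq_ltn_trans (xmin _ x0n0) _; rewrite ltn_neqAle -dimA dimvS ?subvf // andbT.
  apply: contraNneq x0nu => e.
  have : 1 \in Ax x0.
    suff -> : Ax x0 = {:A}%VS by apply: memvf.
    by apply/eqP; rewrite eqEdim subvf e leqnn.
  case/memAx => z zx; have Uz := falg_right_unit (esym zx).
  by rewrite -(unitrMr _ Uz) -zx unitr1.
(* The dimension is 1, p or p^2, and a nonunit excludes p^2. In dimension 1, Ax = Kx makes the left
   annihilator of [x] a two-sided ideal; it is nonzero by dimension, against simplicity. *)
have /(dvdn_pfactor _ _ p_pr)[[|[|[|m]]] mle Wp] := dW.
- have W1 : \dim W = 1%N by [].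
  have xW c : exists k, c * x = k *: x.
    apply/vlineP; suff <- : W = <[x]>%VS by apply: Axl.
    by apply/esym/eqP; rewrite eqEdim -memvE Ax_id W1 dim_vline xn0.
  have [c [cn0 cx]] : exists c : A, c != 0 /\ c * x = 0.
    have : lker (amulr x : 'End(A)) != 0%VS.
      rewrite -dimv_eq0; have := limg_ker_dim (amulr x : 'End(A)) {:A}.
      rewrite -/(Ax x) -/W W1 capfv dimA; case: (\dim _) => // e.
      by have := prime_gt1 p_pr; rewrite -ltn_sqr -e.
    rewrite -vpick0 => c0; exists (vpick (lker (amulr x))); split=> //.
    by have := memv_pick (lker (amulr x)); rewrite memv_ker lfunE => /eqP.
  have : 1 * x = 0.
    apply: (central_simple_ideal (P := fun c => c * x = 0) csA _ _ _ cn0 cx).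
    + by move=> k y z yx zx; rewrite mulrDl -scalerAl yx zx scaler0 addr0.
    + by move=> y z yx; rewrite -mulrA yx mulr0.
    + by move=> y z yx; have [k zx] := xW z; rewrite -mulrA zx -scalerAr yx scaler0.
  by rewrite mul1r => /eqP; rewrite (negbTE xn0).
- by rewrite Wp expn1.
- by rewrite Wp ltnn in W_lt.
- by [].
Qed.

End MinimalLeftIdeal.

Lemma exists_linear_iso (K : fieldType) (V W : vectType K) (U : {vspace W}) :
  \dim {:V} = \dim U -> exists2 th : 'Hom(V, W), lker th == 0%VS & limg th = U.
Proof.
move=> dimE; pose X := tcast (esym dimE) (vbasis U).
have Xb : basis_of U X by rewrite val_tcast vbasisP.
pose g v := \sum_(i < \dim {:V}) coord (vbasis {:V}) i v *: X`_i.
have gL : linear g.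
  move=> k u v; rewrite scaler_sumr -big_split; apply: eq_bigr => i _ /=.
  by rewrite linearP scalerDl scalerA.
have [th thE] : exists th : 'Hom(V, W), th =1 g.
  exists (linfun (HB.pack_for {linear V -> W} g (GRing.isLinear.Build K V W _ g gL))).
  by move=> v; rewrite lfunE.
have ker0 : lker th == 0%VS.
  rewrite -subv0; apply/subvP => v; rewrite memv_ker thE => /eqP gv.
  rewrite memv0 (coord_vbasis (memvf v)) big1 // => i _.
  have := congr1 (coord X i) gv; rewrite coord_sum_free ?(basis_free Xb) // linear0.
  by move=> ->; rewrite scale0r.
exists th => //; apply/eqP; rewrite eqEdim limg_dim_eq ?(eqP ker0) ?capv0 //.
rewrite dimE leqnn andbT; apply/subvP => _ /memv_imgP[v _ ->]; rewrite thE.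
by apply: memv_suml => i _; rewrite memvZ // (basis_mem Xb) // memt_nth.
Qed.

(** The left ideal [W], identified with [S] as a vector space by [th], is a faithful module, so [B]
    is the full endomorphism algebra of [S] by dimension. It then contains the multiplications by
    [S] and the automorphism [sg], whose p-th power is 1. *)
Lemma split_is_cyclic (p : nat) (F : fieldType) (B : falgType F)
    (S : splittingFieldType F) :
    prime p -> csa_of_degree p B -> ~ is_division B -> cyclic_ext_of_degree p S ->
  is_cyclic_algebra p B.
Proof.
move=> p_pr [csB dimB] ndivB Scyc; have [_ Scyclic dimS] := Scyc.
have [W [dimW WB]] := exists_left_ideal p_pr csB dimB ndivB.
have [th th0 thW] : exists2 th : 'Hom(S, B), lker th == 0%VS & limg th = W.
  by apply: exists_linear_iso; rewrite dimS dimW.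
have thK := lker0_lfunK th0.
have Kth w : w \in W -> th (th^-1%VF w) = w by rewrite -thW => /limg_lfunVK.
have th_in s : th s \in W by rewrite -thW memv_img ?memvf.
have faithful b : (forall s, b * th s = 0) -> b = 0.
  move=> bth; apply/eqP; apply: contraT => b0.
  have : forall s, 1 * th s = 0.
    apply: (central_simple_ideal (P := fun b => forall s, b * th s = 0) csB _ _ _ b0 bth).
    - by move=> k y z yx zx s; rewrite mulrDl -scalerAl yx zx scaler0 addr0.
    - by move=> y z yx s; rewrite -mulrA yx mulr0.
    - by move=> y z yx s; rewrite -mulrA -[z * _]Kth ?WB.
  move/(_ 1); rewrite mul1r => th1; have := thK 1.
  by rewrite th1 linear0 => /esym/eqP; rewrite oner_eq0.
pose Lam (b : B) : 'Hom(S, S) := (th^-1 \o (amull b \o th))%VF.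
have LamE b s : th (Lam b s) = b * th s by rewrite !comp_lfunE lfunE /= Kth ?WB.
have LamL : linear Lam.
  move=> k b c; apply/lfunP => s; rewrite add_lfunE scale_lfunE !comp_lfunE !lfunE /=.
  by rewrite mulrDl -scalerAl linearP.
have Lam0 b : Lam b = 0 -> b = 0.
  by move=> b0; apply: faithful => s; rewrite -LamE b0 zero_lfunE linear0.
have [|G _ GK] := linear_inj_bij LamL Lam0.
  by rewrite dimB -[p in LHS]dimS !dimvf /dim /= mulnn.
have GE e s : G e * th s = th (e s) by rewrite -LamE GK.
have eqB b c : (forall s, b * th s = c * th s) -> b = c.
  move=> bc; apply/eqP; rewrite -subr_eq0; apply/eqP/faithful => s.
  by rewrite mulrBl bc subrr.
pose f0 s := G (amull s); have f0E s t : f0 s * th t = th (s * t) by rewrite GE lfunE.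
have f0H : semimorph id f0.
  split=> [s t|k s|s t|]; apply: eqB => u.
  - by rewrite mulrDl !f0E mulrDl linearD.
  - by rewrite -[RHS]scalerAl !f0E -scalerAl linearZ.
  - by rewrite -mulrA !f0E mulrA.
  - by rewrite f0E !mul1r.
have [f fE] := semimorph_lrmorph f0H.
have /cyclicP[sg sgE] := Scyclic.
pose x := G (ahval (gal_repr sg)).
have xE s : x * th s = th (sg s) by rewrite GE.
apply: (is_cyclic_algebraI (S := S) (sg := sg) (c := 1) (f := f) (x := x)) => //.
- exact: prime_gt0.
- exact: oner_neq0.
- apply: eqB => s; rewrite scale1r mul1r.
  have -> l : x ^+ l * th s = th (iter l sg s).
    by elim: l => [|l IHl]; rewrite ?mul1r // exprS -mulrA IHl xE.
  by rewrite -(cyclic_order Scyc sgE) iter_gal_order.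
- by move=> s; apply: eqB => t; rewrite !fE -!mulrA xE !f0E xE rmorphM.
Qed.

(** * The division case *)

(** The carrier is unchanged and [j] is the identity; only the field structure is added. *)
Lemma commutative_division_fieldExt (F : fieldType) (S0 : falgType F) :
    commutative ( *%R : S0 -> S0 -> S0) -> is_division S0 ->
  exists (S : fieldExtType F) (j : S -> S0), semimorph id j /\ bijective j.
Proof.
move=> S0C S0div.
pose com := GRing.PzRing_hasCommutativeMul.Build S0 S0C.
pose R1 := HB.pack_for comUnitRingType (Falgebra.sort S0) com.
pose fld := GRing.ComUnitRing_isField.Build R1 S0div.
pose S := HB.pack_for (fieldExtType F) (Falgebra.sort S0) com fld.
by exists S, (fun x => x); split; [split | exists (fun x => x)].
Qed.

(** * Cyclic field extensions from an automorphism of prime order *)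

Section CyclicAutomorphism.
Variables (p : nat) (F : fieldType).
Hypothesis p_pr : prime p.

(** The product of X - sg^l(b) over l < p has coefficients fixed by [sg], as its factors are
    permuted cyclically; so it is a polynomial over [F]. The product over a basis splits, and its
    roots generate [S]. *)
Lemma cyclic_automorphism_splitting (S : fieldExtType F) (sg : S -> S) :
    semimorph id sg -> (forall s, iter p sg s = s) ->
    (forall s, sg s = s -> exists k, s = k%:A) ->
  splitting_field_axiom S.
Proof.
move=> sgH sg_p sg_fix; have [g gE] := semimorph_rmorph sgH.
pose X b := [seq iter l sg b | l <- iota 0 p].
pose rs := flatten [seq X b | b <- vbasis {:S}].
have Xprod b : \prod_(r <- X b) ('X - r%:P) \is a polyOver 1%VS.
  apply/polyOverP => m; have /vlineP : exists k, (\prod_(r <- X b) ('X - r%:P))`_m = k *: 1.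
    apply: sg_fix; rewrite -gE -coef_map; congr (_`_m).
    rewrite rmorph_prod !big_map /= -{1 2}(subn0 p) -!/(index_iota 0 p) !big_mkord.
    transitivity (\prod_(l < p) ('X - (iter l.+1 sg b)%:P)).
      under eq_bigr => l _ do rewrite rmorphB /= map_polyX map_polyC /= gE. by [].
    have p_gt0 := prime_gt0 p_pr; case: (p) p_gt0 sg_p => // q _ sg_q.
    by rewrite big_ord_recr big_ord_recl /= -[sg _]/(iter q.+1 sg b) sg_q mulrC.
  by [].
exists (\prod_(r <- rs) ('X - r%:P)).
  rewrite /rs big_flatten big_map; apply: rpred_prod => b _; exact: Xprod.
exists rs; first by rewrite eqpxx.
apply/eqP; rewrite eqEsubv subvf; apply/subvP => v _.
rewrite (coord_vbasis (memvf v)) memv_suml // => i _; rewrite memvZ // seqv_sub_adjoin //.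
apply/flattenP; exists (X (vbasis {:S})`_i).
  by apply/mapP; exists (vbasis {:S})`_i; rewrite ?memt_nth.
apply/mapP; exists 0%N => //; by rewrite mem_iota prime_gt0.
Qed.

(** By Artin's theorem the Galois group is generated by [sg], whose fixed field is [F]; its order
    divides p and is not 1. *)
Lemma cyclic_automorphism_galois (S : splittingFieldType F) (sg : S -> S) :
    semimorph id sg -> (forall s, iter p sg s = s) ->
    (forall s, sg s = s -> exists k, s = k%:A) -> (exists s, sg s != s) ->
  exists g : gal_of {:S},
    [/\ cyclic_ext_of_degree p S, 'Gal({:S} / 1)%g = <[g]>%g & forall s, g s = sg s].
Proof.
move=> sgH sg_p sg_fix [s0 sg_s0].
have [sl slE] := semimorph_lrmorph sgH; have [_ sgZ sgM sg1] := sgH.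
have [|g g_gal gE'] := @kAut_to_gal F S 1%AS {:S}%AS (linfun sl).
  rewrite kAutfE; apply/kHomP; split=> [x y _ _|x /vlineP[k ->]].
    by rewrite !lfunE /= !slE sgM.
  by rewrite lfunE /= slE sgZ sg1.
have gE s : g s = sg s by rewrite -gE' ?memvf // lfunE /= slE.
have fixE : fixedField <[g]>%g = 1%VS.
  apply/eqP; rewrite eqEsubv sub1v andbT; apply/subvP => s sF.
  apply/vlineP/sg_fix; rewrite -gE.
  by move/fixedFieldP: sF => -> //; rewrite ?memvf ?cycle_id.
have galE : 'Gal({:S} / 1)%g = <[g]>%g.
  by rewrite -{1}fixE gal_fixedField.
have Sgal : galois 1 {:S} by apply/galois_fixedField; rewrite galE.
have g_p : #[g]%g = p.
  have : (#[g]%g %| p)%N.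
    rewrite order_dvdn; apply/gal_eqP => s _; rewrite gal_id gal_expgE -[RHS](sg_p s).
    by elim: (p) => //= l ->; rewrite gE.
  case/primeP: p_pr => _ /[apply] /orP[|/eqP//]; rewrite order_eq1 => /eqP g1.
  by rewrite -gE g1 gal_id eqxx in sg_s0.
exists g; split=> //; split=> //; first by rewrite galE cycle_cyclic.
by have := galois_dim Sgal; rewrite dimv1 divn1 galE -orderE g_p.
Qed.

Lemma cyclic_field_of (S0 : falgType F) (sg0 : S0 -> S0) :
    commutative ( *%R : S0 -> S0 -> S0) -> is_division S0 ->
    semimorph id sg0 -> (forall s, iter p sg0 s = s) ->
    (forall s, sg0 s = s -> exists k, s = k%:A) -> (exists s, sg0 s != s) ->
  exists (S : splittingFieldType F) (g : gal_of {:S}) (j : S -> S0),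
    [/\ cyclic_ext_of_degree p S, 'Gal({:S} / 1)%g = <[g]>%g, semimorph id j
      & forall s, j (g s) = sg0 (j s)].
Proof.
move=> S0C S0div sg0H sg0_p sg0_fix [s0 sg_s0].
have [S1 [j1 [j1H [k1 jK kJ]]]] := commutative_division_fieldExt S0C S0div.
have k1H := semimorph_inv j1H jK kJ.
pose sg1 := k1 \o (sg0 \o j1).
have sg1H : semimorph id sg1 := semimorph_comp (semimorph_comp j1H sg0H) k1H.
have j1iter l s : j1 (iter l sg1 s) = iter l sg0 (j1 s).
  by elim: l => //= l <-; rewrite kJ.
have sg1_p s : iter p sg1 s = s by apply: (can_inj jK); rewrite j1iter.
have sg1_fix s : sg1 s = s -> exists k, s = k%:A.
  move/(congr1 j1); rewrite /= kJ => /sg0_fix[k sk]; exists k.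
  by apply: (can_inj jK); rewrite (semimorph_alg j1H).
have ax := cyclic_automorphism_splitting sg1H sg1_p sg1_fix.
pose S := HB.pack_for (splittingFieldType F) (FieldExt.sort S1)
  (FieldExt_isSplittingField.Build F S1 ax).
have [|g [gc gE ge]] := @cyclic_automorphism_galois S sg1 sg1H sg1_p sg1_fix.
  exists (k1 s0); rewrite -(inj_eq (can_inj jK)) /sg1 /= !kJ; exact: sg_s0.
by exists S, g, j1; split=> // s; rewrite ge; apply: kJ.
Qed.

End CyclicAutomorphism.

Lemma semimorph_unit (K K' : fieldType) (h : K -> K') (A : falgType K)
    (A' : falgType K') (f : A -> A') x :
  semimorph h f -> x \is a GRing.unit -> f x \is a GRing.unit.
Proof.
by case=> _ _ fM f1 Ux; apply: (@falg_right_unit _ _ _ (f x^-1)); rewrite -fM mulrV.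
Qed.

(** * Norms and triviality of cocycles *)

Section CyclicDescent.
Variables (F : fieldType) (L : splittingFieldType F) (h : gal_of {:L}).
Local Notation n := #[h]%g.

(* lam is a norm as soon as some power of it prime to n is, lam ^+ n being
   the norm of lam. *)
Lemma norm_of_coprime_exp (lam del : L) m : (0 < m)%N -> coprime m n ->
    lam != 0 -> h lam = lam -> lam ^+ m = \prod_(l < n) iter l h del ->
  exists2 mu, mu != 0 & lam = \prod_(l < n) iter l h mu.
Proof.
move=> m_gt0 co lam0 hlam lamE.
have hl l : iter l h lam = lam by elim: l => //= l ->.
have [[u v] /= uv] := coprimeP _ m_gt0 co.
have {}uv : (u * m = v * n + 1)%N.
  by rewrite -uv subnKC // ltnW // -subn_gt0 uv.
have prodE : \prod_(l < n) iter l h (del ^+ u * lam ^- v) = lam.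
  under eq_bigr => l _.
    rewrite -gal_expgE rmorphM rmorphXn fmorphV rmorphXn /= !gal_expgE hl; over.
  rewrite big_split /= prodrXl -lamE prodr_const card_ord -exprM mulnC uv.
  by rewrite exprVn -exprM exprD expr1 mulrAC divff ?mul1r ?expf_neq0.
exists (del ^+ u * lam ^- v) => //; apply: contraNneq lam0 => mu0.
rewrite -prodE mu0; apply/prodf_eq0; exists (Ordinal (order_gt0 h)) => //=.
Qed.

Section Cocycle.
Variables (A : falgType L) (t t' : A -> A).
Hypotheses (tH : semimorph h t) (tH' : semimorph h t').
Hypotheses (t_n : forall x, iter n t x = x) (t'_n : forall x, iter n t' x = x).
Hypotheses (divA : is_division A) (csA : central_simple A).
Hypothesis dimA : coprime (\dim {:A}) n.
Variable g : A.
Hypotheses (g0 : g != 0) (tg : forall y, t y * g = g * t' y).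

(* t = Inn(g) t'; the cocycle g is trivial up to a scalar mu, by taking
   determinants of the semilinear map z |-> g t'(z). *)
Lemma cocycle_trivial : exists2 v, v != 0 &
  forall y, t' y = y -> t (v * y * v^-1) = v * y * v^-1.
Proof.
have [tD tZ tM t1] := tH; have [tD' tZ' tM' t1'] := tH'.
pose rho z := g * t' z.
have rhoD : {morph rho : x y / x + y} by move=> x y; rewrite /rho tD' mulrDr.
have rhoZ k x : rho (k *: x) = h k *: rho x by rewrite /rho tZ' scalerAr.
have Ug := divA g0.
(* [G l] is the product g t'(g) ... t'^(l-1)(g), which intertwines the l-th iterates of [t] and
   [t']. For l = n both iterates are the identity, so [G n] is central. *)
pose G l := iter l rho 1.
have GE l z : iter l rho z = G l * iter l t' z.
  by elim: l => [|l IHl]; rewrite ?mul1r //= IHl /rho tM' mulrA.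
have tG l y : iter l t y * G l = G l * iter l t' y.
  elim: l y => [|l IHl] y; first by rewrite /= mulr1 mul1r.
  by rewrite /G /= -/(G l) /rho mulrA tg -mulrA -tM' IHl tM' mulrA.
have UG l : G l \is a GRing.unit.
  elim: l => [|l IHl]; first exact: unitr1.
  by rewrite /= unitrMl // (semimorph_unit tH').
have [lam GlamE] : exists lam, G n = lam%:A.
  by apply: central_center => // y; have := tG n y; rewrite t_n t'_n.
have lam0 : lam != 0.
  by apply: contraTneq (UG n) => lam0; rewrite GlamE lam0 scale0r unitr0.
have rho_n z : iter n rho z = lam *: z by rewrite GE t'_n GlamE mulr_algl.
have hlam : h lam = lam.
  have : rho (iter n rho 1) = iter n rho (rho 1) by rewrite -iterS iterSr.
  rewrite !rho_n rhoZ /rho t1' mulr1 => /eqP.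
  by rewrite -subr_eq0 -scalerBl scaler_eq0 (negbTE g0) orbF subr_eq0 => /eqP.
have [del delE] := det_semilinear rhoD rhoZ rho_n.
have dimA_gt0 : (0 < \dim {:A})%N.
  by rewrite lt0n; apply: contraNneq (oner_neq0 A) => /eqP;
    rewrite dimv_eq0 -memv0 => /eqP <-; apply: memvf.
have [mu mu0 muE] := norm_of_coprime_exp dimA_gt0 dimA lam0 hlam delE.
(* Dividing by [mu] makes the n-th iterate the identity, and descent then gives a nonzero fixed
   vector, as in Hilbert 90. *)
pose rm z := mu^-1 *: rho z.
have rmE l z : iter l rm z = (\prod_(i < l) iter i h mu)^-1 *: iter l rho z.
  elim: l => [|l IHl]; first by rewrite big_ord0 invr1 scale1r.
  rewrite big_ord_recl /= IHl /rm rhoZ fmorphV rmorph_prod scalerA.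
  by rewrite [in RHS]invfM.
have rmD : {morph rm : x y / x + y} by move=> x y; rewrite /rm rhoD scalerDr.
have rmZ k x : rm (k *: x) = h k *: rm x by rewrite /rm rhoZ !scalerA mulrC.
have rm_n x : iter n rm x = x by rewrite rmE rho_n -muE scalerA mulVf // scale1r.
have [v v0 vE] := descent_nonzero rmD rmZ rm_n (lt0n_neq0 dimA_gt0).
exists v => // y yE; have Uv := divA v0.
have vE' : g * t' v = mu *: v by rewrite -[in RHS]vE scalerA divff // scale1r.
pose z := v * y * v^-1; rewrite -/z; have zv : z * v = v * y by rewrite mulrVK.
apply: (mulIr Uv); apply: (can_inj (scalerK mu0)).
rewrite scalerAr -vE' mulrA tg -mulrA -tM' zv tM' yE mulrA vE'.
by rewrite scalerAl.
Qed.

End Cocycle.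
End CyclicDescent.

Lemma symbol_division_is_cyclic (p : nat) (F : fieldType) (L : splittingFieldType F)
    (omega : L) (omega_prim : p.-primitive_root omega) (h : gal_of {:L})
    (B : falgType F) (k : nat) (a d : L) (c : F) :
    prime p -> galois 1 {:L} -> 'Gal({:L} / 1)%g = <[h]>%g -> coprime #[h]%g p ->
    a != 0 -> c != 0 -> h a = a ^+ k * d ^+ p -> h omega = omega ^+ k ->
    k ^ #[h]%g = 1 %[mod p] -> \dim {:B} = (p ^ 2)%N ->
    is_division (symbol_alg omega_prim a c%:A) ->
    alg_iso (ext_scalars B L) (symbol_alg omega_prim a c%:A) ->
  is_cyclic_algebra p B.
Proof.
move=> p_pr Lgal hgen n_p a0 c0 ha hw kn dimB divT [Psi0 [Psi' PsiK KPsi]].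
have p_gt1 := prime_gt1 p_pr; have p_gt0 := ltnW p_gt1.
set T := symbol_alg omega_prim a c%:A in divT Psi0 Psi' PsiK KPsi.
set si := symbol_i omega_prim a c%:A; set sj := symbol_j omega_prim a c%:A.
pose Psi : ext_scalars B L -> T := Psi0.
have PsiH : semimorph id Psi := lrmorph_semimorph Psi0.
have Psi'H : semimorph id Psi' := semimorph_inv PsiH PsiK KPsi.
have cL0 : c%:A != 0 :> L by rewrite -in_algE fmorph_eq0.
have sij : si * sj = omega *: (sj * si) := symbol_ij omega_prim a c%:A p_gt1.
have Uj : sj \is a GRing.unit by apply: symbol_j_unit.
have Ui : si \is a GRing.unit by apply: symbol_i_unit.
have [||||| t' [tH' t'_n t'i t'j]] :=
  @symbol_twist F L h p omega omega_prim p_gt1 n_p a c%:A a0 cL0 k 1 d 1.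
- exact: ha.
- by rewrite gal_alg expr1 expr1n mulr1.
- by rewrite muln1.
- exact: kn.
- by rewrite exp1n.
have {}t'j : t' sj = sj by apply: t'j.
have [tD' tZ' tM' t1'] := tH'.
pose t := Psi \o (ext_scalars_gal h \o Psi').
have tH : semimorph h t.
  exact: semimorph_comp (semimorph_comp Psi'H (ext_scalars_gal_semimorph B h)) PsiH.
have t_n x : iter #[h]%g t x = x.
  have -> l : iter l t x = Psi (iter l (@ext_scalars_gal F L B h) (Psi' x)).
    by elim: l => [|l /= ->]; rewrite /t /= ?KPsi ?PsiK.
  have -> l (y : ext_scalars B L) : iter l (@ext_scalars_gal F L B h) y
      = [ffun r => iter l h (y r)].
    by elim: l => [|l /= ->]; apply/ffunP => r; rewrite !ffunE.
  rewrite -[RHS]KPsi; congr (Psi0 _); apply/ffunP => r.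
  by rewrite ffunE iter_gal_order.
have n_gt0 := order_gt0 h.
(* [iter #[h]%g.-1 t'] is the inverse of [t'], so its composite with [t] is L-linear and
   Skolem-Noether applies. *)
have [g g0 gE] : exists2 g, g != 0 & forall x, t (iter #[h]%g.-1 t' x) * g = g * x.
  apply: symbol_skolem_noether => //.
  apply: (eq_semimorph (h := h \o iter #[h]%g.-1 h)).
    by move=> x; rewrite /= -iterS prednK // iter_gal_order.
  exact: semimorph_comp (semimorph_iter _ tH') tH.
have {}gE y : t y * g = g * t' y by rewrite -gE -iterSr prednK // t'_n.
have csT : central_simple T by apply: symbol_central_simple.
have co : coprime (\dim {:T}) #[h]%g.
  by rewrite dim_symbol_alg coprime_sym coprimeXr.
have [v v0 vE] := cocycle_trivial tH tH' t_n t'_n divT csT co g0 gE.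
have Uv := divT v v0.
have tens_H := tens_semimorph L B.
have phiH : semimorph (in_alg L) (fun b : B => Psi (tens b (1 : L))).
  exact: semimorph_comp tens_H PsiH.
have phi_inj : injective (fun b : B => Psi (tens b (1 : L))).
  by move=> b b' /(can_inj PsiK)/tens_inj.
have lift y : t' y = y -> exists b : B, Psi (tens b (1 : L)) = v * y * v^-1.
  move/vE => fixed; have [|b bE] := @ext_scalars_gal_fixed F L B h Lgal hgen (Psi' (v * y * v^-1)).
    by rewrite -{2}fixed /t /= PsiK.
  by exists b; rewrite -bE; apply: KPsi.
have memE y : (y \in 'C[si]%VS) = (y * si == si * y) by apply/cent1vP/eqP.
(* [si] is the image under [t'] of a multiple of a power of [si], and [y] commutes with that
   power. *)
have t'E y : y \in 'C[si]%VS -> t' y \in 'C[si]%VS.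
  rewrite !memE => /eqP yi; have [e [r siE]] := t'i #[h]%g.-1.
  have {}siE : si = t' (e *: si ^+ r) by rewrite -siE -iterS prednK // t'_n.
  apply/eqP; rewrite [in LHS]siE [in RHS]siE -!tM' -scalerAr -scalerAl.
  have e' : y * si ^+ r = si ^+ r * y by apply: commrX.
  by rewrite e'.
(* The centralizer of [si] consists of the L-combinations of powers of [si], hence is commutative;
   [S0] is its fixed ring under [t']. *)
have [||S0 [io [ioH io_inj _ ioE [ioS [X XE]]]]] :=
  algebra_descent Lgal hgen (E := 'C[si]%VS) tH' t'_n _ _ t'E.
- exact: cent1v1.
- move=> x y; rewrite !memE => /eqP xi /eqP yi.
  by rewrite -mulrA yi mulrA xi mulrA.
have [ioD ioZ ioM io1] := ioH.
have S0C : commutative ( *%R : S0 -> S0 -> S0).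
  move=> x y; apply: io_inj; rewrite !ioM.
  have [xE _] := ioE x; have [yE _] := ioE y; move: xE yE.
  move: (io x) (io y) => {x}x {y}y; rewrite !memE => /eqP xi /eqP yi.
  rewrite (symbol_algE p_gt1 x) mulr_suml mulr_sumr; apply: eq_bigr => r _.
  have [r0|r0] := eqVneq (r.2 : nat) 0%N.
    rewrite r0 mulr1 -scalerAl -scalerAr.
    by have -> : y * si ^+ r.1 = si ^+ r.1 * y by apply: commrX.
  by rewrite (symbol_cent_i p_gt1 a0 (esym xi) r0) scale0r mul0r mulr0.
have S0div : is_division S0.
  move=> x x0; apply: falg_regular_unit => y yx; apply: (io_inj).
  have Ux : io x \is a GRing.unit.
    by apply: divT; apply: contraNneq x0 => e; apply/eqP/io_inj; rewrite e (semimorph0 ioH).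
  by apply: (mulIr Ux); rewrite -ioM yx (semimorph0 ioH) mul0r.
have conj_in x : exists y, sj * io x / sj = io y.
  have [xE xfix] := ioE x; have [||y yE] := ioS (sj * io x / sj); last by exists y.
    rewrite memE; rewrite memE in xE; apply/eqP.
    exact: skew_conj_comm Uj sij (eqP xE).
  by apply: (mulIr Uj); rewrite -[X in _ * X = _]t'j -tM' !(mulrVK Uj) tM' t'j xfix.
pose sg0 x := sval (sig_eqW (conj_in x)).
have sg0E x : io (sg0 x) = sj * io x / sj by rewrite /sg0; case: sig_eqW.
have sg0H : semimorph id sg0.
  split=> [x y|r x|x y|]; apply: io_inj; rewrite sg0E.
  - by rewrite !ioD !sg0E mulrDr mulrDl.
  - by rewrite !ioZ sg0E -scalerAr -scalerAl.
  - by rewrite !ioM !sg0E !mulrA (mulrVK Uj).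
  - by rewrite io1 mulr1 (divrr Uj).
have sg0_p x : iter p sg0 x = x.
  apply: io_inj.
  have -> l : io (iter l sg0 x) = sj ^+ l * io x * sj ^- l.
    elim: l => [|l IHl]; first by rewrite mul1r invr1 mulr1.
    by rewrite /= sg0E IHl !exprS (invrM Uj (unitrX l Uj)) !mulrA.
  rewrite (symbol_jXp omega_prim a c%:A p_gt1) mulr_algl -[_ *: io x]mulr_algr.
  by rewrite (mulrK (algr_unit T cL0)).
have sg0_fix x : sg0 x = x -> exists r, x = r%:A.
  move=> sx; have [xE xfix] := ioE x; rewrite memE in xE.
  have [||l lE] := symbol_cent_ij p_gt1 a0 cL0 (x := io x).
  - by rewrite (eqP xE).
  - by rewrite -[in LHS](mulrVK Uj (sj * io x)) -sg0E sx.
  have hl : h l = l.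
    by apply: (@algr_inj _ T); rewrite -(semimorph_alg tH') -lE xfix.
  have [r rE] := gal_fixed_alg Lgal hgen hl.
  by exists r; apply: io_inj; rewrite (semimorph_alg ioH) lE rE.
have sg0_neq : exists x, sg0 x != x.
  (* Otherwise [S0] would be [F]; as it spans the centralizer over [L], the element [si] would be a
     scalar and would commute with [sj]. *)
  apply: NNPP => none.
  have sub1 : ('C[si] <= 1)%VS.
    rewrite -XE; apply/span_subvP => _ /mapP[x _ ->].
    have [|r ->] := sg0_fix x; last by rewrite (semimorph_alg ioH) memvZ // memv_line.
    by apply/eqP; apply: contraT => sx; case: none; exists x.
  have /vlineP[l lE] := subvP sub1 _ (cent1v_id si).
  have l0 : l != 0 by apply: contraTneq Ui => l0; rewrite lE l0 scale0r unitr0.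
  move: sij; rewrite lE mulr_algl mulr_algr scalerA => /eqP.
  rewrite -subr_eq0 -scalerBl scaler_eq0 orbC; apply/negP; rewrite negb_or.
  have -> : sj != 0 by apply: contraTneq Uj => ->; rewrite unitr0.
  rewrite subr_eq0 -{1}[l]mul1r (inj_eq (mulIf l0)) eq_sym -[omega]expr1.
  by rewrite -(prim_order_dvd omega_prim) dvdn1 gtn_eqF.
have [S [sg [j [Scyc sgE jH jsg]]]] :=
  cyclic_field_of p_pr S0C S0div sg0H sg0_p sg0_fix sg0_neq.
have [jD jZ jM j1] := jH.
have f_ex s : exists b : B, Psi (tens b (1 : L)) = v * io (j s) * v^-1.
  by apply: lift; have [] := ioE (j s).
pose f0 s := sval (sig_eqW (f_ex s)).
have f0E s : Psi (tens (f0 s) (1 : L)) = v * io (j s) * v^-1.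
  by rewrite /f0; case: sig_eqW.
have [x xE] := lift _ t'j.
have [phiD phiZ phiM phi1] := phiH.
have f0H : semimorph id f0.
  split=> [s u|r s|s u|]; apply: phi_inj; rewrite /= f0E.
  - by rewrite phiD !f0E jD ioD mulrDr mulrDl.
  - by rewrite phiZ f0E jZ ioZ -scalerAr -scalerAl.
  - by rewrite phiM !f0E jM ioM !mulrA (mulrVK Uv).
  - by rewrite phi1 j1 io1 mulr1 (divrr Uv).
have [f fE] := semimorph_lrmorph f0H.
apply: (is_cyclic_algebraI (S := S) (sg := sg) (c := c) (f := f) (x := x)) => //.
- apply: phi_inj; rewrite /= (semimorphX phiH) (semimorph_alg phiH) /= xE.
  have -> l : (v * sj * v^-1) ^+ l = v * sj ^+ l * v^-1.
    elim: l => [|l IHl]; first by rewrite mulr1 (divrr Uv).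
    by rewrite !exprS IHl !mulrA (mulrVK Uv).
  by rewrite (symbol_jXp omega_prim a c%:A p_gt1) mulr_algr -scalerAl (divrr Uv).
- move=> s; apply: phi_inj; rewrite /= !phiM !fE !f0E xE jsg sg0E.
  by rewrite !mulrA !(mulrVK Uv) (mulrVK Uj).
Qed.

(** As the class is fixed, the norm of [b] is [b ^+ n] times a p-th power. With u n = v p + 1, the
    u-th power of the norm lies in [F] and is [b] times a p-th power. *)
Lemma fixedclass_base_field (p : nat) (F : fieldType) (L : splittingFieldType F)
    (h : gal_of {:L}) (b : L) :
    galois 1 {:L} -> 'Gal({:L} / 1)%g = <[h]>%g -> coprime #[h]%g p -> (0 < p)%N ->
    fixedclass p b ->
  exists (c : F) (e : L), [/\ c != 0, e != 0 & c%:A = b * e ^+ p].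
Proof.
move=> Lgal hgen n_p p_gt0 [b0 bfix]; set n := #[h]%g in n_p.
have n_gt0 : (0 < n)%N := order_gt0 h.
have [D D0 ND] : exists2 D : L, D != 0 & \prod_(l < n) iter l h b = b ^+ n * D ^+ p.
  elim: (n) => [|l [D D0 IHl]]; first by exists 1; rewrite ?oner_neq0 // big_ord0 expr1n mulr1.
  have [d d0 hd] := bfix (h ^+ l)%g ltac:(by rewrite hgen mem_cycle).
  exists (D * d); first by rewrite mulf_neq0.
  by rewrite big_ord_recr /= IHl -gal_expgE hd exprSr exprMn -!mulrA; congr (_ * _);
    rewrite mulrCA.
pose N := \prod_(l < n) iter l h b.
have hN : h N = N.
  rewrite rmorph_prod; apply: (big_ord_shift _ (G := fun l => iter l h b)).
  exact: iter_gal_order.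
have [[u v] /= uv] := coprimeP _ n_gt0 n_p.
have {}uv : (u * n = v * p + 1)%N by rewrite -uv subnKC // ltnW // -subn_gt0 uv.
have [|c cE] := gal_fixed_alg Lgal hgen (x := N ^+ u); first by rewrite rmorphXn /= hN.
have e0 : b ^+ v * D ^+ u != 0 by rewrite mulf_neq0 ?expf_neq0.
have ceq : c%:A = b * (b ^+ v * D ^+ u) ^+ p.
  rewrite -cE /N ND exprMn -!exprM mulnC uv exprD expr1 exprMn -!exprM.
  by rewrite [(p * u)%N]mulnC mulrA [b * _]mulrC.
exists c, (b ^+ v * D ^+ u); split=> //.
apply: contraNneq (mulf_neq0 b0 (expf_neq0 p e0)) => c0.
by rewrite -ceq c0 scale0r.
Qed.

(** The disjunction concerns the converse: if [A] is not a division algebra, [B] is a matrix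
    algebra, which is cyclic in the present sense only if [F] has a cyclic field extension of degree
    p. Over the real numbers with p = 3 and a = b = 1 there is no such extension. *)
Theorem proposition3p4 (p : nat) (F : fieldType) (L : splittingFieldType F)
    (omega : L) (omega_prim : p.-primitive_root omega)
    (alpha chi : {morphism 'Gal({:L} / 1)%g >-> {unit 'F_p}}) :
  prime p -> odd p -> p \notin [pchar F] ->
  ~ (forall z : L, z ^+ p = 1 -> z \in 1%VS) ->
  <<1; omega>>%VS = {:L}%VS ->
  cyclotomic_char alpha ->
  forall a b : L,
    eigenclass chi a ->
    eigenclass (fun h => (alpha h * (chi h)^-1)%g) b ->
  let A := symbol_alg omega_prim a b in
  (exists B : falgType F, csa_of_degree p B /\ alg_iso (ext_scalars B L) A)
  /\
  (forall B : falgType F, csa_of_degree p B -> alg_iso (ext_scalars B L) A ->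
     (exists S : splittingFieldType F, cyclic_ext_of_degree p S)
       \/ is_division A ->
     (is_cyclic_algebra p B <->
      exists a' b' : L,
        [/\ eigenclass alpha a', fixedclass p b'
          & alg_iso A (symbol_alg omega_prim a' b')])).
Proof.
move=> p_pr _ _ _ L_omega alpha_cyc a b aE bE A.
have p_gt1 := prime_gt1 p_pr; have p_gt0 := ltnW p_gt1.
split; first exact: (symbol_descends omega_prim p_pr L_omega alpha_cyc aE bE).
move=> B csaB iso SA; have [csB dimB] := csaB; have [a0 _] := aE; have [b0 _] := bE.
split=> [Bcyc|[a' [b' [a'E b'E iso']]]].
  have csC : central_simple (ext_scalars B L).
    by apply: central_simple_iso (alg_iso_sym iso) _; apply: symbol_central_simple.
  have [a' [b' [a'E b'E iso']]] :=
    cyclic_algebra_symbol omega_prim p_gt1 alpha_cyc dimB csC Bcyc.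
  by exists a', b'; split=> //; apply: alg_iso_trans (alg_iso_sym iso) iso'.
have Lgal := cyclotomic_galois omega_prim p_pr L_omega.
have [h [hH hE n_p]] := cyclotomic_generator omega_prim p_pr L_omega alpha_cyc.
have division_iso (A1 A2 : falgType L) : alg_iso A1 A2 -> is_division A1 -> is_division A2.
  case=> f [g fK gK] divA1 x x0; rewrite -[x]gK; apply: rmorph_unit; apply: divA1.
  by apply: contraNneq x0 => gx; rewrite -[x]gK gx rmorph0.
have [divA|ndivA] := classic (is_division A); last first.
  have [[S Scyc]|//] := SA; apply: (split_is_cyclic p_pr csaB _ Scyc) => divB.
  apply/ndivA/(division_iso _ _ iso)/division_ext_scalars => //.
  rewrite dimB coprimeXr //; have := galois_dim Lgal.
  by rewrite dimv1 divn1 hE => ->.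
have [c [e [c0 e0 cE]]] := fixedclass_base_field Lgal hE n_p p_gt0 b'E.
have [a'0 a'h] := a'E; have [d d0 ha] := a'h h hH; have [b'0 _] := b'E.
pose i := symbol_i omega_prim a' b'; pose j := symbol_j omega_prim a' b'.
(* Rescaling [j] by [e] multiplies [b'] by a p-th power and turns it into the element [c] of [F]. *)
have [f [fH _ _]] := @symbol_universal L p omega omega_prim p_gt1 a' c%:A L idfun
  (symbol_alg omega_prim a' b') i (e *: j) (symbol_iXp omega_prim a' b' p_gt1)
  ltac:(by rewrite exprZn (symbol_jXp omega_prim a' b' p_gt1) scalerA mulrC -cE)
  ltac:(by rewrite -scalerAr -scalerAl (symbol_ij omega_prim a' b' p_gt1) !scalerA mulrC).
have isoc : alg_iso (symbol_alg omega_prim a' c%:A) (symbol_alg omega_prim a' b').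
  apply: (alg_isoI fH); apply: symbol_hom_bij => //; last by rewrite dim_symbol_alg.
  by rewrite -in_algE fmorph_eq0.
have isoA := alg_iso_trans iso' (alg_iso_sym isoc).
apply: (symbol_division_is_cyclic (omega_prim := omega_prim) (h := h)
  (k := (val (alpha h) : 'F_p)) (a := a') (d := d) (c := c)) => //.
- by rewrite alpha_cyc ?(prim_expr_order omega_prim).
- by apply: Fp_natr_mod => //; rewrite natrX Fp_natr_val char_val_exp.
- exact: division_iso isoA divA.
- exact: alg_iso_trans iso isoA.
Qed.
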